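(* Let $M$ be an $n$-dimensional manifold, let $r\geq 1$ be an integer, let $\lambda\colon G^{r}(n)\to Gl(m,\mathbb{R})$ be a linear representation, and let $p\colon V\to M$ be the vector bundle associated with $F^{r}(M)$ under $\lambda$, i.e. $V=F^{r}(M)\times^{G^{r}(n)}\mathbb{R}^{m}$. Then the homomorphism $h_V\colon \mathrm{AUT}\,V\to \mathrm{Diff}\,M$ is surjective.
   Context: All manifolds are connected, second countable, $C^\infty$, without boundary and finite-dimensional; all maps, bundles and representations are $C^\infty$. $\mathrm{Diff}\,M$ is the group of diffeomorphisms of $M$. For a real vector bundle $p\colon V\to M$, $\mathrm{AUT}\,V$ is the group of diffeomorphisms $\Phi\colon V\to V$ mapping each fibre $V_x$ onto a fibre $V_{x'}$ by an $\mathbb{R}$-linear isomorphism, and $h_V\colon\mathrm{AUT}\,V\to\mathrm{Diff}\,M$ is the homomorphism sending $\Phi$ to the diffeomorphism $\varphi(x)=x'$ induced on the base, so $p\circ\Phi=\varphi\circ p$. The $r$-th order frame bundle $\pi_r\colon F^{r}(M)\to M$ is the set of $r$-jets $j_0^r\xi\in J^r(\mathbb{R}^n,M)$ at $0$ such that $\xi_*\colon T_0\mathbb{R}^n\to T_{\xi(0)}M$ is a linear isomorphism, with $\pi_r(j_0^r\xi)=\xi(0)$. It is a principal bundle with structure group the $r$-th order jet group $G^r(n)$, the Lie group of $r$-jets $j_0^rf\in J^r(\mathbb{R}^n,\mathbb{R}^n)$ with $f(0)=0$ and $f_*\colon T_0\mathbb{R}^n\to T_0\mathbb{R}^n$ a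 linear isomorphism (acting on the right by composition of jets). *)

(* Defs.v *)
From HB Require Import structures.
From mathcomp Require Import all_boot all_order all_algebra.
From mathcomp Require Import all_classical all_reals all_analysis.
Import numFieldNormedType.Exports.
Import Order.TTheory GRing.Theory Num.Theory.

Set Implicit Arguments.
Unset Strict Implicit.
Unset Printing Implicit Defensive.

Local Open Scope classical_set_scope.
Local Open Scope ring_scope.

Section Calculus.
Variables (R : realType) (V W : normedModType R).

(* Only used for finite-dimensional V and open U, where requiring all
   directional derivatives of the differentiable map f to be C^k is the usual
   notion of C^(k+1). *)
Fixpoint Ck (k : nat) (U : set V) (f : V -> W) : Prop :=
  match k with
  | 0%N => forall x, U x -> {for x, continuous f}
  | k'.+1 => (forall x, U x -> differentiable f x) /\
             (forall v : V, Ck k' U (fun x => 'D_v f x))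
  end.

Definition smooth_on (U : set V) (f : V -> W) : Prop := forall k, Ck k U f.

Definition smooth_near (x : V) (f : V -> W) : Prop :=
  exists2 U, open_nbhs x U & smooth_on U f.

(* Iterated directional derivatives 'D_v1 ('D_v2 ( ... f)). *)
Definition iter_derive (s : seq V) (f : V -> W) : V -> W :=
  foldr (fun v g => fun x => 'D_v g x) f s.

(* All derivatives of order 0, ..., r agree at x. *)
Definition agree_to_order (r : nat) (x : V) (f g : V -> W) : Prop :=
  forall s : seq V, (size s <= r)%N -> iter_derive s f x = iter_derive s g x.

End Calculus.

Record chart (T E : Type) := Chart { cdom : set T ; cmap :> T -> E }.

Record charted (R : realType) (E : normedModType R) := Charted {
  carrier :> Type ;
  atlas : set (chart carrier E) }.
Arguments atlas {R E} _ _.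

Definition euclid (R : realType) (E : normedModType R) : charted E :=
  @Charted R E E [set Chart setT id].

Section SmoothMaps.
Variables (R : realType).

(* f is smooth on a neighbourhood of x: in any charts c around x and d around
   f x, it has a smooth local expression g, with d \o f = g \o c near x.
   The clause [cdom d (f x')] contains the continuity of f at x. *)
Definition smooth_at (E E' : normedModType R) (X : charted E) (Y : charted E')
    (f : X -> Y) (x : X) : Prop :=
  forall c d, atlas X c -> atlas Y d -> cdom c x -> cdom d (f x) ->
  exists g : E -> E', smooth_near (c x) g /\
    \forall y \near c x, forall x', cdom c x' -> c x' = y ->
      cdom d (f x') /\ d (f x') = g y.

Definition smooth_map (E E' : normedModType R) (X : charted E) (Y : charted E')
    (f : X -> Y) : Prop := forall x, smooth_at f x.

Definition Diff (E : normedModType R) (X : charted E) : set (X -> X) :=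
  [set f | smooth_map f /\
     exists2 g : X -> X, smooth_map g & cancel f g /\ cancel g f].

End SmoothMaps.

Record manifold (R : realType) (n : nat) := Manifold {
  mspace :> topologicalType ;
  matlas : set (chart mspace 'rV[R]_n) ;
  mhausdorff : hausdorff_space mspace ;
  msecond_countable : @second_countable mspace ;
  mconnected : connected [set: mspace] ;
  mcover : forall x, exists2 c, matlas c & cdom c x ;
  mopen : forall c, matlas c -> open (cdom c) ;
  (* charts are homeomorphisms onto open subsets of R^n *)
  minj : forall c, matlas c -> set_inj (cdom c) c ;
  mcontinuous : forall c, matlas c ->
    forall x, cdom c x -> {for x, continuous (c : mspace -> 'rV[R]_n)} ;
  mopen_map : forall c, matlas c ->
    forall W, open W -> W `<=` cdom c -> open (c @` W) ;
  mcompatible : forall c d, matlas c -> matlas d ->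
    exists2 g : 'rV[R]_n -> 'rV[R]_n,
      smooth_on (c @` (cdom c `&` cdom d)) g &
      forall x, cdom c x -> cdom d x -> d x = g (c x) }.
Arguments matlas {R n} _ _.

Definition mcharted (R : realType) (n : nat) (M : manifold R n) :
    charted 'rV[R]_n := @Charted R _ M (matlas M).
Coercion mcharted : manifold >-> charted.

Section Jets.
Variables (R : realType) (n r : nat) (E : normedModType R) (X : charted E).
Implicit Types xi eta : 'rV[R]_n -> X.

(* Jets are represented by functions that are smooth near 0. *)
Definition smooth0 xi : Prop :=
  smooth_at (X := euclid 'rV[R]_n) (Y := X) xi 0.

Definition same_jet xi eta : Prop :=
  xi 0 = eta 0 /\
  forall c, atlas X c -> cdom c (xi 0) ->
    agree_to_order r 0 (cmap c \o xi) (cmap c \o eta).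

(* The jet j^r_0 xi, as an equivalence class. *)
Definition jet xi : set ('rV[R]_n -> X) :=
  [set eta | smooth0 eta /\ same_jet xi eta].

(* The tangent map of xi at 0, read in charts, is a linear isomorphism. *)
Definition regular xi : Prop :=
  smooth0 xi /\
  forall c, atlas X c -> cdom c (xi 0) ->
    bijective ('d (cmap c \o xi : 'rV[R]_n -> E) 0).

Definition frame_bundle : set (set ('rV[R]_n -> X)) :=
  [set jet xi | xi in regular].

(* The graph of the projection pi_r of the frame bundle. *)
Definition frame_point (a : set ('rV[R]_n -> X)) (x : X) : Prop :=
  exists xi, [/\ regular xi, a = jet xi & xi 0 = x].

(* The composite of a jet at 0 with a jet from 0 to 0; it is again a full
   equivalence class as it does not depend on the representatives. *)
Definition jet_comp (a : set ('rV[R]_n -> X))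
    (g : set ('rV[R]_n -> 'rV[R]_n)) : set ('rV[R]_n -> X) :=
  [set eta | exists xi f, [/\ a xi, g f & jet (xi \o f) eta]].

End Jets.

Section JetGroup.
Variables (R : realType) (n r : nat).

Definition ejet (f : 'rV[R]_n -> 'rV[R]_n) : set ('rV[R]_n -> 'rV[R]_n) :=
  jet r (X := euclid 'rV[R]_n) f.

Definition ejet_comp (a b : set ('rV[R]_n -> 'rV[R]_n)) :
    set ('rV[R]_n -> 'rV[R]_n) :=
  jet_comp r (X := euclid 'rV[R]_n) a b.

Definition jet_group : set (set ('rV[R]_n -> 'rV[R]_n)) :=
  [set ejet f | f in
    [set f | regular (X := euclid 'rV[R]_n) f /\ f 0 = 0]].

(* Multi-indices of order 1, ..., r. *)
Definition mindex : Type :=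
  {al : {ffun 'I_n -> 'I_r.+1} | (0 < \sum_i al i <= r)%N}.

Definition jet_coeffs : normedModType R :=
  'M[R]_(#|{: mindex}|, n).

Definition poly_map (a : jet_coeffs) (x : 'rV[R]_n) : 'rV[R]_n :=
  \sum_(al : mindex)
    (\prod_(i < n) x ord0 i ^+ val al i) *: row (enum_rank al) a.

(* Smoothness refers to the global chart of the jet group given by the Taylor
   coefficients, whose inverse is a |-> ejet (poly_map a).
   Values of lam outside jet_group are irrelevant. *)
Definition linear_representation (m : nat)
    (lam : set ('rV[R]_n -> 'rV[R]_n) -> 'M[R]_m) : Prop :=
  [/\ forall g, jet_group g -> lam g \in unitmx,
      forall g h, jet_group g -> jet_group h ->
        lam (ejet_comp g h) = lam g *m lam h &
      smooth_on [set a | jet_group (ejet (poly_map a))]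
        (fun a : jet_coeffs => lam (ejet (poly_map a)))].

End JetGroup.

(* The data of a vector bundle over B that AUT and h_V refer to; no laws are
   imposed, and addition is only meaningful within a fibre. *)
Record vb_data (R : realType) (EB : normedModType R) (B : charted EB)
    (E : normedModType R) := VbData {
  vtotal :> charted E ;
  vproj : vtotal -> B ;
  vadd : vtotal -> vtotal -> vtotal ;
  vscale : R -> vtotal -> vtotal }.

Section AUT.
Variables (R : realType) (EB : normedModType R) (B : charted EB).
Variables (E : normedModType R) (V : vb_data B E).

Definition fibre (x : B) : set V := [set z | vproj z = x].

Definition fibre_iso (x x' : B) (Phi : V -> V) : Prop :=
  [/\ set_bij (fibre x) (fibre x') Phi,
      forall z w, fibre x z -> fibre x w ->
        Phi (vadd z w) = vadd (Phi z) (Phi w) &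
      forall k z, fibre x z -> Phi (vscale k z) = vscale k (Phi z)].

Definition AUT : set (V -> V) :=
  [set Phi | Diff (X := V) Phi /\ forall x, exists x', fibre_iso x x' Phi].

End AUT.

(* The map x |-> x' such that Phi maps the fibre over x into the one over x';
   x' is unique as no fibre is empty, and x is only a default value. *)
Definition h_V (R : realType) (n : nat) (M : manifold R n)
    (E : normedModType R) (V : vb_data M E) (Phi : V -> V) : M -> M :=
  fun x => xget x
    [set x' : M | forall z : V, vproj z = x :> M -> vproj (Phi z) = x' :> M].

Section AssociatedBundle.
Variables (R : realType) (n : nat) (M : manifold R n) (r m : nat).
Variable lam : set ('rV[R]_n -> 'rV[R]_n) -> 'M[R]_m.

(* The orbit of (u, v) under (u, v) . g = (u . g, lam(g)^-1 v). *)
Definition orbit_of (q : set ('rV[R]_n -> M) * 'cV[R]_m) :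
    set (set ('rV[R]_n -> M) * 'cV[R]_m) :=
  [set q' | exists2 g, jet_group r g &
    q' = (jet_comp r (X := M) q.1 g, invmx (lam g) *m q.2)].

Record assoc := Assoc {
  aorbit :> set (set ('rV[R]_n -> M) * 'cV[R]_m) ;
  aorbitP : exists q, frame_bundle r (X := M) q.1 /\ aorbit = orbit_of q }.

HB.instance Definition _ := gen_eqMixin assoc.
HB.instance Definition _ := gen_choiceMixin assoc.

Lemma assoc_point (z : assoc) :
  exists x : M, exists q, frame_point r (X := M) q.1 x /\ aorbit z = orbit_of q.
Proof.
case: (aorbitP z) => q [[xi xireg xiE] zE].
by exists (xi 0), q; split => //; exists xi; split.
Qed.

Definition assoc_proj (z : assoc) : M := projT1 (cid (assoc_point z)).

(* [u, v] + [u, w] = [u, v + w] and k [u, v] = [u, k v]; z is only a default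
   value, used for the sum of vectors in different fibres. *)
Definition assoc_add (z w : assoc) : assoc :=
  xget z [set y | exists u v1 v2,
    [/\ aorbit z (u, v1), aorbit w (u, v2) & aorbit y (u, v1 + v2)]].

Definition assoc_scale (k : R) (z : assoc) : assoc :=
  xget z [set y | exists u v, aorbit z (u, v) /\ aorbit y (u, k *: v)].

(* The local section x |-> j^r_0 (t |-> c^-1 (c x + t)) of the frame bundle
   over the domain of a chart c of M. *)
Definition frame_field (c : chart M 'rV[R]_n) (x : M) : set ('rV[R]_n -> M) :=
  [set eta | exists xi : 'rV[R]_n -> M,
    (\forall t \near (0 : 'rV[R]_n), cdom c (xi t) /\ c (xi t) = c x + t) /\
    jet r (X := M) xi eta].

(* The local trivialisation [frame_field c x, v] |-> (c x, v). *)
Definition assoc_chart (c : chart M 'rV[R]_n) :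
    chart assoc ('rV[R]_n * 'cV[R]_m) :=
  Chart (assoc_proj @^-1` cdom c)
    (fun z => (c (assoc_proj z),
       xget 0 [set v | aorbit z (frame_field c (assoc_proj z), v)])).

Definition assoc_bundle : vb_data M ('rV[R]_n * 'cV[R]_m)%type :=
  @VbData R _ M _
    (@Charted R _ assoc [set assoc_chart c | c in matlas M])
    assoc_proj assoc_add assoc_scale.

End AssociatedBundle.

(* Main.v *)
(** A frame [j^r_0 xi] at [x] is carried by a diffeomorphism [phi] to the frame
    [j^r_0 (phi o xi)] at [phi x]; this commutes with the right action of the
    jet group, so [phi] lifts to [[u, v] |-> [phi_* u, v]] on the associated
    bundle, and the lift of the inverse of [phi] is inverse to it.  If [h] is
    the expression of [phi] in charts, the lift reads
    [(y, v) |-> (h y, lam (j^r_0 (t |-> h (y + t) - h y)) v)].  It is smooth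
    because the jet is that of the Taylor polynomial of [h] at [y] (by the
    symmetry of iterated derivatives), whose coefficients are smooth in [y].

    Inverses in the jet group are built order by order, without the inverse
    function theorem: if [F o G = id + e] with [e] flat to order [k >= 1], then
    [F o G o (id - e)] agrees with [id] to order [k + 1]. *)
From HB Require Import structures.
Require Import Defs.
From mathcomp Require Import all_boot all_order all_algebra.
From mathcomp Require Import all_classical all_reals all_analysis.
From mathcomp Require Import ring.
Import numFieldNormedType.Exports.
Import Order.TTheory GRing.Theory Num.Theory.

Set Implicit Arguments.
Unset Strict Implicit.
Unset Printing Implicit Defensive.

Local Open Scope classical_set_scope.
Local Open Scope ring_scope.

(** * Calculus of C^k maps *)

Section Calculus.
Context {R : realType}.

(** A point of the bundle is handled through representatives: a regular germ [xi] together with a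
    vector [v]. Passing to another germ over the same base point needs an element of the jet group,
    and coordinates with respect to a germ are well defined only if the matrix of this element is
    determined. Hence the jet group must be shown to act transitively and freely on the frames over
    a point; inverses of jets serve these two facts and the symmetry of the orbit relation. Jets
    compare iterated derivatives along all lists of vectors, in every order, whereas [lam] is
    assumed smooth in one coefficient per multi-index. Symmetry of derivatives bridges the two, so
    that in charts the matrix of the lift becomes the composite of [lam], read in coefficients, with
    a smooth coefficient map. *)

Lemma near_eq_differentiable (V W : normedModType R) (f g : V -> W) (x : V) :
  (\forall y \near x, f y = g y) -> differentiable f x -> differentiable g x.
Proof.
move=> fg /diff_locallyP[fc fE].
have gE : g \o shift x = cst (g x) + 'd f x +o_ 0 id.
  apply/eqaddoP => e e0; move/eqaddoP : fE => /(_ e e0).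
  have : \forall t \near 0, f (t + x) = g (t + x).
    by move: fg; rewrite (near_shift 0) subr0.
  apply: filterS2 => t ftx; rewrite !fctE/= /shift /= ftx.
  by rewrite (nbhs_singleton fg).
apply/diff_locallyP.
by have -> := diff_unique fc gE.
Qed.

Lemma near_near (T : topologicalType) (x : T) (P : T -> Prop) :
  (\forall y \near x, P y) -> \forall y \near x, \forall z \near y, P z.
Proof. exact: nbhs_interior. Qed.

Lemma near_eq_derive_near (V W : normedModType R) (f g : V -> W) (x v : V) :
  (\forall y \near x, f y = g y) -> \forall y \near x, 'D_v f y = 'D_v g y.
Proof.
by move=> /near_near; apply: filterS => y /near_eq_derive; exact.
Qed.

Lemma open_near (T : topologicalType) (U : set T) (P : T -> Prop) x :
  open U -> (forall y, U y -> P y) -> U x -> \forall y \near x, P y.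
Proof. by move=> oU UP Ux; apply: filterS UP _; apply: open_nbhs_nbhs. Qed.

(** Openness of [U] turns equality on [U] into equality near each of its points, which passes to
    every directional derivative; this is what the induction needs. *)
Lemma Ck_ext (V W : normedModType R) k (U : set V) (f g : V -> W) :
  open U -> (forall x, U x -> f x = g x) -> Ck k U f -> Ck k U g.
Proof.
move=> oU; elim: k f g => [|k IH] f g fg /=.
  move=> fc x Ux; have fgx := open_near oU fg Ux.
  move: (fc x Ux); rewrite /prop_for /continuous_at -(fg _ Ux).
  by apply: cvg_trans; apply: near_eq_cvg; apply: filterS fgx.
move=> [df Df]; split=> [x Ux|v].
  exact: near_eq_differentiable (open_near oU fg Ux) (df x Ux).
apply: IH (Df v) => x Ux.
by apply: near_eq_derive; exact: open_near oU fg Ux.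
Qed.

Lemma Ck_sub (V W : normedModType R) k (U U' : set V) (f : V -> W) :
  U' `<=` U -> Ck k U f -> Ck k U' f.
Proof.
move=> UU; elim: k f => [|k IH] f /=; first by move=> fc x /UU; exact: fc.
by move=> [df Df]; split=> [x /UU|v]; [exact: df|exact: IH].
Qed.

Lemma CkW (V W : normedModType R) k (U : set V) (f : V -> W) :
  Ck k.+1 U f -> Ck k U f.
Proof.
elim: k f => [|k IH] f.
  by move=> [df _] x Ux; apply: differentiable_continuous; exact: df.
by move=> [df Df]; split=> // v; apply: IH; exact: Df.
Qed.

Lemma Ck_cst (V W : normedModType R) k (U : set V) (w : W) :
  Ck k U (fun _ : V => w).
Proof.
elim: k w => [|k IH] w /=; first by move=> x _; exact: cst_continuous.
split=> // v; have -> : (fun x : V => 'D_v (fun _ : V => w) x) = (fun=> 0).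
  by apply/funext => x; rewrite derive_cst.
exact: IH.
Qed.

Lemma Ck_add (V W : normedModType R) k (U : set V) (f g : V -> W) :
  open U -> Ck k U f -> Ck k U g -> Ck k U (fun x => f x + g x).
Proof.
move=> oU; elim: k f g => [|k IH] f g.
  move=> fc gc x Ux; apply: cvgD; [exact: fc|exact: gc].
move=> [df Df] [dg Dg]; split => [x Ux|v].
  by apply: differentiableD; [exact: df|exact: dg].
apply: Ck_ext (IH _ _ (Df v) (Dg v)) => // x Ux.
by rewrite -deriveD//; apply: diff_derivable; [exact: df|exact: dg].
Qed.

(** Gives a bare function the canonical structure under which the rules for differentials of linear
    maps apply. *)
Definition pack_linear (V W : normedModType R) (L : V -> W) (lL : linear L) :
  {linear V -> W} := HB.pack L (GRing.isLinear.Build _ _ _ _ L lL).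

Lemma linear_derive (V W W' : normedModType R) (L : W -> W') (f : V -> W) x v :
  linear L -> continuous L -> differentiable f x ->
  'D_v (fun y => L (f y)) x = L ('D_v f x).
Proof.
move=> lL cL df.
have dL : differentiable L (f x).
  exact: (@linear_differentiable _ _ _ (pack_linear lL) _ cL).
rewrite deriveE; last exact: differentiable_comp.
rewrite (diff_comp df dL) /= (@diff_lin _ _ _ (pack_linear lL)) //=.
by rewrite deriveE.
Qed.

Lemma linear_differentiable_comp (V W W' : normedModType R) (L : W -> W')
    (f : V -> W) x :
  linear L -> continuous L -> differentiable f x ->
  differentiable (fun y => L (f y)) x.
Proof.
move=> lL cL df; apply: differentiable_comp => //.
exact: (@linear_differentiable _ _ _ (pack_linear lL) _ cL).
Qed.

Lemma Ck_linear (V W W' : normedModType R) k (U : set V) (L : W -> W')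
    (f : V -> W) :
  open U -> linear L -> continuous L -> Ck k U f -> Ck k U (fun x => L (f x)).
Proof.
move=> oU lL cL; elim: k f => [|k IH] f.
  move=> fc x Ux; apply: continuous_comp; [exact: fc|exact: cL].
move=> [df Df]; split => [x Ux|v].
  by apply: linear_differentiable_comp => //; exact: df.
apply: Ck_ext (IH _ (Df v)) => // x Ux.
by rewrite (linear_derive v lL cL (df x Ux)).
Qed.

(* Canonical structures need a named head constant. *)
Definition scale_fun (W : normedModType R) (k : R) (w : W) : W := k *: w.

Lemma scale_is_bilinear (W : normedModType R) :
  bilinear_for
    (GRing.Scale.Law.clone _ _ *:%R _) (GRing.Scale.Law.clone _ _ *:%R _)
    (@scale_fun W).
Proof.
split=> [u'|u] a x y /=; rewrite /scale_fun.
- by rewrite scalerDl scalerA.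
- by rewrite scalerDr !scalerA mulrC.
Qed.

HB.instance Definition _ (W : normedModType R) :=
  bilinear_isBilinear.Build R R W W _ _ (@scale_fun W) (@scale_is_bilinear W).

(** Chain rule for the bilinear map [(k, w) |-> k *: w] after the pair [(f, g)]. *)
Lemma is_diff_scale (V W : normedModType R) (f df : V -> R) (g dg : V -> W) x :
  is_diff x f df -> is_diff x g dg ->
  is_diff x (fun y => f y *: g y) (fun v => f x *: dg v + df v *: g x).
Proof.
move=> dfx dgx.
pose B (p : R * W) := p.1 *: p.2.
have cB : continuous B by move=> p; exact: scale_continuous.
have dB p : is_diff p B (fun q => p.1 *: q.2 + q.1 *: p.2).
  apply: DiffDef.
    exact: (@differentiable_bilin _ _ _ _ (@scale_fun W)).
  exact: (@diff_bilin _ _ _ _ (@scale_fun W)).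
exact: (@is_diff_comp _ _ _ _ (fun y => (f y, g y)) _ B).
Qed.

Lemma differentiable_scale (V W : normedModType R) (f : V -> R) (g : V -> W) x :
  differentiable f x -> differentiable g x ->
  differentiable (fun y => f y *: g y) x.
Proof.
move=> /differentiableP df /differentiableP dg.
by have := is_diff_scale df dg; move=> ?; exact: ex_diff.
Qed.

Lemma derive_scale (V W : normedModType R) (f : V -> R) (g : V -> W) x v :
  differentiable f x -> differentiable g x ->
  'D_v (fun y => f y *: g y) x = f x *: 'D_v g x + 'D_v f x *: g x.
Proof.
move=> df dg; rewrite !deriveE//; last exact: differentiable_scale.
have dfx := differentiableP df; have dgx := differentiableP dg.
have dfg := is_diff_scale dfx dgx.
by rewrite [in LHS]diff_val.
Qed.

Lemma Ck_scale (V W : normedModType R) k (U : set V) (f : V -> R) (g : V -> W) :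
  open U -> Ck k U f -> Ck k U g -> Ck k U (fun x => f x *: g x).
Proof.
move=> oU; elim: k f g => [|k IH] f g.
  by move=> fc gc x Ux; apply: cvgZ; [exact: fc|exact: gc].
(* The Leibniz rule leaves one factor undifferentiated, so both functions are also kept at order
   [k]. *)
move=> Cf Cg; have [Cf' Cg'] := (CkW Cf, CkW Cg).
move: Cf Cg => [df Df] [dg Dg]; split => [x Ux|v].
  by apply: differentiable_scale; [exact: df|exact: dg].
apply: Ck_ext (Ck_add oU (IH _ _ Cf' (Dg v)) (IH _ _ (Df v) Cg')) => // x Ux.
by rewrite (derive_scale v (df x Ux) (dg x Ux)).
Qed.

Lemma Ck_sum (V W : normedModType R) k (U : set V) (I : Type) (s : seq I)
    (P : pred I) (f : I -> V -> W) :
  open U -> (forall i, P i -> Ck k U (f i)) ->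
  Ck k U (fun x => \sum_(i <- s | P i) f i x).
Proof.
move=> oU Cf; elim: s => [|i s IH].
  by apply: Ck_ext (Ck_cst k U 0) => // x _; rewrite big_nil.
have [Pi|NPi] := boolP (P i).
  apply: Ck_ext (Ck_add oU (Cf _ Pi) IH) => // x _.
  by rewrite big_cons Pi.
by apply: Ck_ext IH => // x _; rewrite big_cons (negbTE NPi).
Qed.

Lemma diff_delta (p q : nat) (W : normedModType R) (F : 'M[R]_(p, q) -> W) x v :
  differentiable F x ->
  'd F x v = \sum_i \sum_j v i j *: 'D_(delta_mx i j) F x.
Proof.
move=> dF; rewrite {1}(matrix_sum_delta v) linear_sum.
apply: eq_bigr => i _; rewrite linear_sum; apply: eq_bigr => j _.
by rewrite linearZ /= deriveE.
Qed.

Lemma coord_linear (p q : nat) (i : 'I_p) (j : 'I_q) :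
  linear (fun M : 'M[R]_(p, q) => M i j).
Proof. by move=> k u v /=; rewrite !mxE. Qed.

(** [Ck] differentiates along fixed directions, while the differential of [F] is applied to a
    direction that varies with the point. Expanding that direction in the matrix basis leaves fixed
    directions with variable scalar coefficients; hence outer maps are defined on matrix spaces. *)
Lemma derive_comp (V W : normedModType R) (p q : nat) (f : V -> 'M[R]_(p, q))
    (F : 'M[R]_(p, q) -> W) x v :
  differentiable f x -> differentiable F (f x) ->
  'D_v (F \o f) x =
  \sum_i \sum_j 'D_v (fun y => f y i j) x *: 'D_(delta_mx i j) F (f x).
Proof.
move=> df dF; rewrite deriveE; last exact: differentiable_comp.
rewrite (diff_comp df dF) /= diff_delta//.
apply: eq_bigr => i _; apply: eq_bigr => j _.
rewrite (linear_derive _ (@coord_linear p q i j) _ df) ?deriveE//.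
exact: coord_continuous.
Qed.

Lemma Ck_coord (V : normedModType R) (p q : nat) k (U : set V)
    (f : V -> 'M[R]_(p, q)) (i : 'I_p) (j : 'I_q) :
  open U -> Ck k U f -> Ck k U (fun x => f x i j).
Proof.
move=> oU; apply: (Ck_linear oU (@coord_linear p q i j)).
exact: coord_continuous.
Qed.

Lemma Ck_mx (V : normedModType R) (p q : nat) k (U : set V)
    (f : V -> 'M[R]_(p, q)) :
  open U -> (forall i j, Ck k U (fun x => f x i j)) -> Ck k U f.
Proof.
move=> oU Cf.
have -> : f = fun x => \sum_i \sum_j f x i j *: delta_mx i j.
  by apply/funext => x; rewrite -matrix_sum_delta.
do 2 (apply: Ck_sum => // ? _).
by apply: Ck_scale => //; exact: Ck_cst.
Qed.

(** With [F] generalised, the induction closes: the chain rule gives products of derivatives of the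
    entries of [f] with composites ['D F \o f], one order lower. *)
Lemma Ck_comp (V W : normedModType R) (p q : nat) k (U : set V)
   (U' : set 'M[R]_(p, q)) (f : V -> 'M[R]_(p, q)) (F : 'M[R]_(p, q) -> W) :
  open U -> (forall x, U x -> U' (f x)) -> Ck k U f -> Ck k U' F ->
  Ck k U (F \o f).
Proof.
move=> oU fU; elim: k F => [|k IH] F Cf CF.
  move=> x Ux; apply: continuous_comp; first exact: Cf.
  by apply: CF; exact: fU.
have Cf' := CkW Cf; case: CF => dF DF; have [df Df] := Cf; split=> [x Ux|v].
  by apply: differentiable_comp; [exact: df|apply: dF; exact: fU].
have : Ck k U (fun x => \sum_i \sum_j
    'D_v (fun y => f y i j) x *: ('D_(delta_mx i j) F \o f) x).
  apply: Ck_sum => // a _; apply: Ck_sum => // b _.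
  apply: Ck_scale => //; last exact: (IH _ Cf' (DF _)).
  have [_ CD] := Ck_coord (k := k.+1) a b oU Cf; exact: CD.
apply: Ck_ext => // x Ux.
by rewrite (derive_comp v (df x Ux) (dF _ (fU x Ux))).
Qed.

End Calculus.

(** * Germs of smooth maps and their jets *)

Section Smooth.
Context {R : realType}.

Lemma smooth_on_derive (V W : normedModType R) (U : set V) (f : V -> W) v :
  smooth_on U f -> smooth_on U (fun x => 'D_v f x).
Proof. by move=> sf k; have [_] := sf k.+1; exact. Qed.

Lemma smooth_on_differentiable (V W : normedModType R) (U : set V)
    (f : V -> W) x : smooth_on U f -> U x -> differentiable f x.
Proof. by move=> sf; have [df _] := sf 1%N; exact: df. Qed.

Lemma smooth_near_near (V W : normedModType R) (f : V -> W) x :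
  smooth_near x f -> \forall y \near x, smooth_near y f.
Proof.
move=> [U [oU Ux] sf]; apply: (open_near oU _ Ux) => y Uy.
by exists U => //; split.
Qed.

Lemma smooth_near_differentiable (V W : normedModType R) (f : V -> W) x :
  smooth_near x f -> differentiable f x.
Proof. by move=> [U [_ Ux] sf]; exact: smooth_on_differentiable sf Ux. Qed.

Lemma smooth_near_continuous (V W : normedModType R) (f : V -> W) x :
  smooth_near x f -> {for x, continuous f}.
Proof.
by move=> /smooth_near_differentiable; exact: differentiable_continuous.
Qed.

Lemma smooth_near_derive (V W : normedModType R) (f : V -> W) x v :
  smooth_near x f -> smooth_near x (fun y => 'D_v f y).
Proof. by move=> [U xU sf]; exists U => //; exact: smooth_on_derive. Qed.

Lemma smooth_near_ext (V W : normedModType R) (f g : V -> W) x :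
  (\forall y \near x, f y = g y) -> smooth_near x f -> smooth_near x g.
Proof.
move=> fg [U [oU Ux] sf].
pose A := [set y | f y = g y]; exists (U `&` A°).
  split; [by apply: openI => //; exact: open_interior|by split].
move=> k; apply: (@Ck_ext _ _ _ _ _ f).
- by apply: openI => //; exact: open_interior.
- by move=> y [_ /interior_subset].
- by apply: Ck_sub (sf k) => y [].
Qed.

Lemma smooth_near2 (V W W' : normedModType R) (f : V -> W) (g : V -> W') x :
  smooth_near x f -> smooth_near x g ->
  exists2 U, open_nbhs x U & smooth_on U f /\ smooth_on U g.
Proof.
move=> [U xU sf] [U' xU' sg]; exists (U `&` U'); first exact: open_nbhsI.
by split => k; [apply: Ck_sub (sf k) => y []|apply: Ck_sub (sg k) => y []].
Qed.

Lemma smooth_near_cst (V W : normedModType R) (w : W) (x : V) :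
  smooth_near x (fun _ : V => w).
Proof.
exists setT; first by split => //; exact: openT.
by move=> k; exact: Ck_cst.
Qed.

Lemma smooth_near_add (V W : normedModType R) (f g : V -> W) x :
  smooth_near x f -> smooth_near x g -> smooth_near x (fun y => f y + g y).
Proof.
move=> sf sg; have [U xU [cf cg]] := smooth_near2 sf sg; exists U => // k.
by apply: Ck_add => //; case: xU.
Qed.

Lemma smooth_near_scale (V W : normedModType R) (f : V -> R) (g : V -> W) x :
  smooth_near x f -> smooth_near x g -> smooth_near x (fun y => f y *: g y).
Proof.
move=> sf sg; have [U xU [cf cg]] := smooth_near2 sf sg; exists U => // k.
by apply: Ck_scale => //; case: xU.
Qed.

Lemma smooth_near_linear (V W W' : normedModType R) (L : W -> W') (f : V -> W)
    x :
  linear L -> continuous L -> smooth_near x f ->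
  smooth_near x (fun y => L (f y)).
Proof.
move=> lL cL [U [oU Ux] sf]; exists U => // k.
exact: Ck_linear.
Qed.

Lemma smooth_near_sum (V W : normedModType R) (I : Type) (s : seq I)
    (P : pred I) (f : I -> V -> W) x :
  (forall i, P i -> smooth_near x (f i)) ->
  smooth_near x (fun y => \sum_(i <- s | P i) f i y).
Proof.
move=> Cf; elim: s => [|i s IH].
  apply: smooth_near_ext (smooth_near_cst 0 x).
  by near=> y; rewrite big_nil.
have [Pi|NPi] := boolP (P i).
  apply: smooth_near_ext (smooth_near_add (Cf _ Pi) IH).
  by near=> y; rewrite big_cons Pi.
by apply: smooth_near_ext IH; near=> y; rewrite big_cons (negbTE NPi).
Unshelve. all: by end_near. Qed.

Lemma Ck_id (V : normedModType R) k (U : set V) : Ck k U (@id V).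
Proof.
case: k => [|k] /=; first by move=> y _; exact: cvg_id.
split=> // v; have -> : (fun x : V => 'D_v id x) = (fun=> v).
  by apply/funext => y; rewrite derive_id.
exact: Ck_cst.
Qed.

Lemma smooth_near_id (V : normedModType R) (x : V) : smooth_near x id.
Proof.
exists setT; first by split => //; exact: openT.
by move=> k; exact: Ck_id.
Qed.

Lemma smooth_near_coord (V : normedModType R) (p q : nat)
    (f : V -> 'M[R]_(p, q)) i j x :
  smooth_near x f -> smooth_near x (fun y => f y i j).
Proof.
apply: (smooth_near_linear (@coord_linear _ p q i j)).
exact: coord_continuous.
Qed.

Lemma smooth_near_comp (V W : normedModType R) (p q : nat)
   (f : V -> 'M[R]_(p, q)) (F : 'M[R]_(p, q) -> W) x :
  smooth_near x f -> smooth_near (f x) F -> smooth_near x (F \o f).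
Proof.
move=> sf [U' fxU' sF]; have cf := smooth_near_continuous sf.
case: sf => U [oU Ux] sf.
have xA : nbhs x (U `&` f @^-1` U').
  apply: filterI; first exact: open_nbhs_nbhs.
  by apply: cf; exact: open_nbhs_nbhs.
exists (U `&` f @^-1` U')°; first by split; [exact: open_interior|].
move=> k; apply: (@Ck_comp _ _ _ _ _ _ _ U') (sF k).
- exact: open_interior.
- by move=> y /interior_subset [].
- by apply: Ck_sub (sf k) => y /interior_subset [].
Qed.

Lemma iter_derive_near (V W : normedModType R) (f g : V -> W) (x : V) s :
  (\forall y \near x, f y = g y) ->
  \forall y \near x, iter_derive s f y = iter_derive s g y.
Proof.
by move=> fg; elim: s => [|v s IH] //=; exact: near_eq_derive_near.
Qed.

(** The head of the list is the outermost derivative. Splitting off the last entry exposes the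
    innermost one, so agreement becomes a recursion on the functions ['D_v f]. *)
Lemma agreeS (V W : normedModType R) r (x : V) (f g : V -> W) :
  agree_to_order r.+1 x f g <->
  f x = g x /\ forall v, agree_to_order r x (fun y => 'D_v f y)
                                           (fun y => 'D_v g y).
Proof.
have E (h : V -> W) s v :
    iter_derive (rcons s v) h = iter_derive s (fun y => 'D_v h y).
  by rewrite /iter_derive foldr_rcons.
split=> [fg|[fgx fg] s].
  split; first exact: (fg [::]).
  by move=> v s sr; rewrite -!E; apply: fg; rewrite size_rcons.
case/lastP: s => [|s v] //; rewrite size_rcons ltnS !E.
exact: fg.
Qed.

Lemma agree_le (V W : normedModType R) r r' (x : V) (f g : V -> W) :
  (r' <= r)%N -> agree_to_order r x f g -> agree_to_order r' x f g.
Proof. by move=> rr fg s sr; apply: fg; exact: leq_trans rr. Qed.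

Lemma agree0 (V W : normedModType R) r (x : V) (f g : V -> W) :
  agree_to_order r x f g -> f x = g x.
Proof. by move=> /(_ [::]); exact. Qed.

Lemma agree_refl (V W : normedModType R) r (x : V) (f : V -> W) :
  agree_to_order r x f f.
Proof. by []. Qed.

Lemma agree_sym (V W : normedModType R) r (x : V) (f g : V -> W) :
  agree_to_order r x f g -> agree_to_order r x g f.
Proof. by move=> fg s sr; rewrite fg. Qed.

Lemma agree_trans (V W : normedModType R) r (x : V) (f g h : V -> W) :
  agree_to_order r x f g -> agree_to_order r x g h -> agree_to_order r x f h.
Proof. by move=> fg gh s sr; rewrite fg// gh. Qed.

Lemma agree_near (V W : normedModType R) r (x : V) (f g : V -> W) :
  (\forall y \near x, f y = g y) -> agree_to_order r x f g.
Proof.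
by move=> fg s _; exact: (nbhs_singleton (iter_derive_near s fg)).
Qed.

Lemma agree_near2 (V W : normedModType R) r (x : V) (f f' g g' : V -> W) :
  (\forall y \near x, f y = f' y) -> (\forall y \near x, g y = g' y) ->
  agree_to_order r x f' g' -> agree_to_order r x f g.
Proof.
move=> /(agree_near (r := r)) ff' /(agree_near (r := r)) /agree_sym gg' fg.
exact: agree_trans (agree_trans ff' fg) gg'.
Qed.

(** This and the next two rules hold near [x], not only at [x], so that the equality can be
    differentiated again. *)
Lemma derive_add_near (V W : normedModType R) (f g : V -> W) (x v : V) :
  smooth_near x f -> smooth_near x g ->
  \forall y \near x, 'D_v (fun z => f z + g z) y = 'D_v f y + 'D_v g y.
Proof.
move=> /smooth_near_near + /smooth_near_near; apply: filterS2 => y.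
move=> /smooth_near_differentiable df /smooth_near_differentiable dg.
by rewrite deriveD//; exact: diff_derivable.
Qed.

Lemma derive_scale_near (V W : normedModType R) (f : V -> R) (g : V -> W)
    (x v : V) :
  smooth_near x f -> smooth_near x g ->
  \forall y \near x,
    'D_v (fun z => f z *: g z) y = f y *: 'D_v g y + 'D_v f y *: g y.
Proof.
move=> /smooth_near_near + /smooth_near_near; apply: filterS2 => y.
move=> /smooth_near_differentiable df /smooth_near_differentiable dg.
exact: derive_scale.
Qed.

Lemma derive_comp_near (V W : normedModType R) (p q : nat)
    (f : V -> 'M[R]_(p, q)) (F : 'M[R]_(p, q) -> W) x v :
  smooth_near x f -> smooth_near (f x) F ->
  \forall y \near x, 'D_v (F \o f) y =
  \sum_i \sum_j 'D_v (fun z => f z i j) y *: 'D_(delta_mx i j) F (f y).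
Proof.
move=> sf sF; have : \forall y \near x, smooth_near (f y) F.
  exact: (smooth_near_continuous sf) _ (smooth_near_near sF).
apply: filterS2 (smooth_near_near sf) => y.
move=> /smooth_near_differentiable df /smooth_near_differentiable dg.
exact: derive_comp.
Qed.

Lemma agree_add (V W : normedModType R) r (x : V) (f f' g g' : V -> W) :
  smooth_near x f -> smooth_near x f' -> smooth_near x g -> smooth_near x g' ->
  agree_to_order r x f f' -> agree_to_order r x g g' ->
  agree_to_order r x (fun y => f y + g y) (fun y => f' y + g' y).
Proof.
elim: r f f' g g' => [|r IH] f f' g g' sf sf' sg sg'.
  by move=> /agree0 ff /agree0 gg [|//] _ /=; rewrite ff gg.
move=> /agreeS[ff Df] /agreeS[gg Dg]; apply/agreeS; rewrite ff gg.
split=> // v.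
apply: (agree_near2 (derive_add_near v sf sg) (derive_add_near v sf' sg')).
by apply: IH => //; exact: smooth_near_derive.
Qed.

Lemma agree_sum (V W : normedModType R) r (x : V) (I : Type) (s : seq I)
    (f g : I -> V -> W) :
  (forall i, smooth_near x (f i)) -> (forall i, smooth_near x (g i)) ->
  (forall i, agree_to_order r x (f i) (g i)) ->
  agree_to_order r x (fun y => \sum_(i <- s) f i y)
                     (fun y => \sum_(i <- s) g i y).
Proof.
move=> sf sg fg; elim: s => [|i s IH].
  by apply: agree_near; near=> y; rewrite !big_nil.
apply: (agree_near2 _ _ (agree_add (sf i) (sg i) _ _ (fg i) IH)).
- by near=> y; rewrite big_cons.
- by near=> y; rewrite big_cons.
- exact: smooth_near_sum.
- exact: smooth_near_sum.
Unshelve. all: by end_near. Qed.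

Lemma agree_scale (V W : normedModType R) r (x : V) (f f' : V -> R)
    (g g' : V -> W) :
  smooth_near x f -> smooth_near x f' -> smooth_near x g -> smooth_near x g' ->
  agree_to_order r x f f' -> agree_to_order r x g g' ->
  agree_to_order r x (fun y => f y *: g y) (fun y => f' y *: g' y).
Proof.
elim: r f f' g g' => [|r IH] f f' g g' sf sf' sg sg'.
  by move=> /agree0 ff /agree0 gg [|//] _ /=; rewrite ff gg.
move=> fA gA; have [fA' gA'] := (agree_le (leqnSn r) fA, agree_le (leqnSn r) gA).
move: fA gA => /agreeS[ff Df] /agreeS[gg Dg]; apply/agreeS; rewrite ff gg.
split=> // v.
apply: (agree_near2 (derive_scale_near v sf sg) (derive_scale_near v sf' sg')).
by apply: agree_add; (apply: smooth_near_scale || apply: IH) => //;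
  exact: smooth_near_derive.
Qed.

Lemma agree_linear (V W W' : normedModType R) r (x : V) (L : W -> W')
    (f g : V -> W) :
  linear L -> continuous L -> smooth_near x f -> smooth_near x g ->
  agree_to_order r x f g ->
  agree_to_order r x (fun y => L (f y)) (fun y => L (g y)).
Proof.
move=> lL cL.
have E h v : smooth_near x h ->
    \forall y \near x, 'D_v (fun z => L (h z)) y = L ('D_v h y).
  move=> /smooth_near_near; apply: filterS => y.
  by move=> /smooth_near_differentiable; exact: linear_derive.
elim: r f g => [|r IH] f g sf sg.
  by move=> /agree0 fg [|//] _ /=; rewrite fg.
move=> /agreeS[fg Dfg]; apply/agreeS; rewrite fg; split=> // v.
apply: (agree_near2 (E _ v sf) (E _ v sg)).
by apply: IH => //; exact: smooth_near_derive.
Qed.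

Lemma agree_coord (V : normedModType R) (p q : nat) r (x : V)
    (f g : V -> 'M[R]_(p, q)) i j :
  smooth_near x f -> smooth_near x g -> agree_to_order r x f g ->
  agree_to_order r x (fun y => f y i j) (fun y => g y i j).
Proof.
apply: (agree_linear (@coord_linear _ p q i j)).
exact: coord_continuous.
Qed.

(** Same induction as for [Ck_comp]: each term of the chain rule is a product of a derivative of [f]
    and a derivative of [F] composed with [f], so it involves the data to one order less. *)
Lemma agree_comp (V W : normedModType R) (p q : nat) r
   (f f' : V -> 'M[R]_(p, q)) (F F' : 'M[R]_(p, q) -> W) x :
  smooth_near x f -> smooth_near x f' ->
  smooth_near (f x) F -> smooth_near (f x) F' ->
  agree_to_order r x f f' -> agree_to_order r (f x) F F' ->
  agree_to_order r x (F \o f) (F' \o f').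
Proof.
elim: r F F' => [|r IH] F F' sf sf' sF sF' ff FF.
  by case=> [|//] _ /=; rewrite (agree0 FF) (agree0 ff).
have ffx := agree0 ff; have sF'' : smooth_near (f' x) F' by rewrite -ffx.
apply/agreeS; split; first by rewrite /= (agree0 FF) (agree0 ff).
move=> v.
apply: (agree_near2 (derive_comp_near v sf sF) (derive_comp_near v sf' sF'')).
have [_ DF] := (agreeS _ _ _ _).1 FF.
have ff' := agree_le (leqnSn r) ff.
have sD i j h : smooth_near x h ->
    smooth_near x (fun y => 'D_v (fun z => (h z : 'M[R]_(p, q)) i j) y).
  by move=> sh; apply: smooth_near_derive; exact: smooth_near_coord.
have sC i j h H : smooth_near x h -> smooth_near (h x) H ->
    smooth_near x (fun y => 'D_(delta_mx i j) H (h y) : W).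
  move=> sh sH; apply: (smooth_near_comp (F := fun y => 'D_(delta_mx i j) H y));
  [exact: sh|exact: smooth_near_derive].
apply: agree_sum => i; [..|apply: agree_sum => j]; try do 1?[
  by apply: smooth_near_sum => j _; apply: smooth_near_scale; auto
 |by apply: smooth_near_scale; auto].
apply: agree_scale; auto.
- by have [_] := (agreeS _ _ _ _).1 (agree_coord i j sf sf' ff); exact.
- by apply: (IH (fun y => 'D_(delta_mx i j) F y)
      (fun y => 'D_(delta_mx i j) F' y)) => //; exact: smooth_near_derive.
Qed.

End Smooth.

(** * Flat maps and symmetry of second derivatives *)

Section Flat.
Context {R : realType}.

(** The derivative is [f *: 'D_v g + 'D_v f *: g]. In the first term ['D_v g] is one order less
    flat, which the vanishing of [f] repairs by induction; the second is as flat as [g]. *)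
Lemma agree_flat_scale (V W : normedModType R) k (x : V) (f : V -> R)
    (g : V -> W) :
  smooth_near x f -> smooth_near x g -> f x = 0 ->
  agree_to_order k x g (fun=> 0) ->
  agree_to_order k.+1 x (fun y => f y *: g y) (fun=> 0).
Proof.
have D0 v y : 'D_v (fun _ : V => 0 : W) y = 0 by rewrite derive_cst.
elim: k g => [|k IH] g sf sg fx0 g0; apply/agreeS; rewrite fx0 scale0r;
  split=> // v;
  apply: (agree_near2 (g' := fun=> 0 + 0) (derive_scale_near v sf sg)).
- by near=> y; rewrite D0 addr0.
- case=> [|//] _ /=; rewrite fx0 scale0r add0r (agree0 g0) scaler0 addr0 //.
- by near=> y; rewrite D0 addr0.
- apply: agree_add; try exact: smooth_near_cst.
  + by apply: smooth_near_scale => //; exact: smooth_near_derive.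
  + by apply: smooth_near_scale => //; exact: smooth_near_derive.
  + apply: IH => //; first exact: smooth_near_derive.
    have [_ /(_ v) Dg] := (agreeS _ _ _ _).1 g0.
    by apply: agree_trans Dg _; apply: agree_near; near=> y; rewrite D0.
  + apply: agree_trans (_ : agree_to_order _ _ _ (fun y => 'D_v f y *: 0)) _.
      apply: agree_scale => //; try exact: smooth_near_derive.
        exact: smooth_near_cst.
    by apply: agree_near; near=> y; rewrite scaler0.
Unshelve. all: by end_near. Qed.

(** A change of variable tangent to the identity moves a flat map only at the next order. This is
    the gain of one order in the construction of inverses, applied there with [psi = id - e]. *)
Lemma agree_flat_comp (W : normedModType R) n k (x : 'rV[R]_n)
    (psi : 'rV[R]_n -> 'rV[R]_n) (e : 'rV[R]_n -> W) :
  smooth_near x psi -> smooth_near x e ->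
  agree_to_order 1 x psi id -> agree_to_order k x e (fun=> 0) ->
  agree_to_order k.+1 x (e \o psi) e.
Proof.
have D0 v y : 'D_v (fun _ : 'rV[R]_n => 0 : W) y = 0 by rewrite derive_cst.
move=> sp + p1; have px := agree0 p1.
elim: k e => [|k IH] e se e0.
  have se' : smooth_near (psi x) e by rewrite px.
  rewrite -[X in agree_to_order _ _ _ X]/(e \o id).
  by apply: agree_comp => //; exact: smooth_near_id.
have se' : smooth_near (psi x) e by rewrite px.
apply/agreeS; split; first by rewrite /= px.
move=> v.
have IE : \forall y \near x, 'D_v e y = \sum_i \sum_j
     'D_v (fun z : 'rV[R]_n => z i j) y *: 'D_(delta_mx i j) e y.
  exact: (derive_comp_near v (smooth_near_id x) se).
apply: (agree_near2 (derive_comp_near v sp se') IE).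
have sc i j : smooth_near x (fun y => 'D_v (fun z => psi z i j) y).
  by apply: smooth_near_derive; exact: smooth_near_coord.
have sc1 i j : smooth_near x (fun y => 'D_v (fun z : 'rV[R]_n => z i j) y).
  apply: smooth_near_derive.
  by apply: (smooth_near_coord (f := id)); exact: smooth_near_id.
have sD i j : smooth_near x (fun y => 'D_(delta_mx i j) e y).
  exact: smooth_near_derive.
have sDp i j : smooth_near x (fun y => 'D_(delta_mx i j) e (psi y)).
  apply: (smooth_near_comp (F := fun y => 'D_(delta_mx i j) e y)) => //.
  by rewrite px.
apply: agree_sum => i; [..|apply: agree_sum => j]; try do 1?[
  by apply: smooth_near_sum => j _; apply: smooth_near_scale; auto
 |by apply: smooth_near_scale; auto].
have De0 : agree_to_order k x (fun y => 'D_(delta_mx i j) e y) (fun=> 0).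
  have [_ /(_ (delta_mx i j)) De] := (agreeS _ _ _ _).1 e0.
  by apply: agree_trans De _; apply: agree_near; near=> y; rewrite D0.
(* The intermediate term keeps the coefficients of [psi] but evaluates the derivative of [e] at the
   unmoved point: the induction hypothesis handles the move of the point, flatness the change of
   coefficients. *)
apply: (@agree_trans _ _ _ _ _ _
  (fun y => 'D_v (fun z => psi z i j) y *: 'D_(delta_mx i j) e y)).
  apply: agree_scale; auto; first exact: agree_refl.
  exact: (IH (fun y => 'D_(delta_mx i j) e y) (sD i j) De0).
(* This difference vanishes at [x] since [psi] is tangent to the identity, so its product with the
   derivative of [e] is flat to one more order than that derivative. *)
pose f y := 'D_v (fun z => psi z i j) y - 'D_v (fun z : 'rV[R]_n => z i j) y.
have sf : smooth_near x f.
  apply: smooth_near_add => //.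
  have -> : (fun y => - 'D_v (fun z : 'rV[R]_n => z i j) y) =
    (fun y => (fun=> -1 : R) y *: 'D_v (fun z : 'rV[R]_n => z i j) y).
    by apply/funext => y; rewrite scaleN1r.
  by apply: smooth_near_scale => //; exact: smooth_near_cst.
have f0 : f x = 0.
  apply/eqP; rewrite subr_eq0; apply/eqP.
  have [_ /(_ v)] := (agreeS _ _ _ _).1
    (agree_coord i j sp (smooth_near_id x) p1).
  exact: agree0.
have := agree_flat_scale sf (sD i j) f0 De0.
set g := (fun y => 'D_v (fun z : 'rV[R]_n => z i j) y *: 'D_(delta_mx i j) e y).
move=> fe0; have sg : smooth_near x g by exact: smooth_near_scale.
have := agree_add (smooth_near_scale sf (sD i j)) (smooth_near_cst 0 x) sg sg
  fe0 (@agree_refl _ _ _ k.+1 x g).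
apply: agree_near2; near=> y.
  by rewrite /g /f -scalerDl subrK.
by rewrite add0r.
Unshelve. all: by end_near. Qed.

End Flat.

(** * Symmetry of second derivatives by the mean value theorem *)

Section Schwarz.
Context {R : realType}.

Lemma is_derive_line (V : normedModType R) (F : V -> R) (a v : V) (s : R) :
  differentiable F (a + s *: v) ->
  is_derive s 1 (fun t => F (a + t *: v)) ('D_v F (a + s *: v)).
Proof.
move=> dF.
have dl : is_diff s (fun t : R => a + t *: v) (fun t : R => t *: v).
  have := is_diffD (is_diff_cst a s) (is_diff_scalel s v).
  by move=> H; apply: is_diff_eq H _; apply/funext => t; rewrite fctE add0r.
have dFl : differentiable (fun t : R => F (a + t *: v)) s.
  by apply: (@differentiable_comp _ _ _ _ _ F); [exact: ex_diff|exact: dF].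
apply: DeriveDef; first exact: diff_derivable.
rewrite deriveE// (@diff_comp _ _ _ _ (fun t : R => a + t *: v) F) /=; last 2 first.
- exact: ex_diff.
- exact: dF.
by rewrite deriveE// (_ : 'd _ s 1 = v) //; case: dl => _ ->; rewrite scale1r.
Qed.

Lemma MVT_line (V : normedModType R) (F : V -> R) (a v : V) (h : R) :
  0 < h -> (forall s, 0 <= s <= h -> differentiable F (a + s *: v)) ->
  exists2 c, 0 <= c <= h & F (a + h *: v) - F a = 'D_v F (a + c *: v) * h.
Proof.
move=> h0 dF.
have [s| |c ch] := @MVT_segment R (fun t => F (a + t *: v))
   (fun t => 'D_v F (a + t *: v)) 0 h (ltW h0).
- rewrite in_itv /= => /andP[s0 sh]; apply: is_derive_line; apply: dF.
  by rewrite !ltW.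
- apply: continuous_in_subspaceT => u; rewrite inE /= in_itv /= => sh.
  have /(@ex_derive _ _ _ _ _ _ _) /derivable1_diffP := is_derive_line (dF u sh).
  exact: differentiable_continuous.
- by rewrite scale0r addr0 subr0 => ->; exists c.
Qed.

Lemma derive_translate (V W : normedModType R) (f : V -> W) (c x v : V) :
  'D_v (fun z => f (z + c)) x = 'D_v f (x + c).
Proof.
rewrite /derive.
have -> // : (fun h : R => h^-1 *: (((fun z => f (z + c)) \o shift x) (h *: v)
    - f (x + c))) =
  (fun h : R => h^-1 *: ((f \o shift (x + c)) (h *: v) - f (x + c))).
by apply/funext => t; rewrite /= addrA.
Qed.

Lemma schwarz_scalar (V : normedModType R) (f : V -> R) (x v w : V) :
  smooth_near x f -> 'D_v (fun y => 'D_w f y) x = 'D_w (fun y => 'D_v f y) x.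
Proof.
(* Two mean value theorems for the second difference over a small square;
   exchanging [v] and [w] leaves that difference unchanged. *)
have square (v' w' : V) (D : V -> R) h :
    (forall y, D y = 'D_w' (fun z => 'D_v' f z) y) -> 0 < h ->
    (forall s t, 0 <= s <= h -> 0 <= t <= h ->
      smooth_near (x + s *: v' + t *: w') f) ->
    exists s t, [/\ 0 <= s <= h, 0 <= t <= h &
      f (x + h *: v' + h *: w') - f (x + h *: w') - (f (x + h *: v') - f x) =
      D (x + s *: v' + t *: w') * h * h].
  move=> DE0 h0 sf.
  have h00 : 0 <= (0 : R) <= h by rewrite lexx ltW.
  have hh : 0 <= h <= h by rewrite lexx ltW.
  have df y : smooth_near y f -> differentiable f y.
    exact: smooth_near_differentiable.
  have sfh s t : 0 <= s <= h -> 0 <= t <= h -> smooth_near (x + t *: w' + s *: v') f.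
    by move=> sh th; rewrite addrAC; exact: sf.
  have sf0 s : 0 <= s <= h -> smooth_near (x + s *: v') f.
    by move=> sh; have := sf s 0 sh h00; rewrite scale0r addr0.
  (* The second difference is the increment of [G] along [v'], and the [v']-derivative of [G] is an
     increment of ['D_v' f] along [w']: one mean value theorem for each. *)
  pose G y := f (y + h *: w') - f y.
  have dsh y : differentiable (fun z : V => z + h *: w') y.
    by apply: differentiableD => //; exact: differentiable_cst.
  have dG s : 0 <= s <= h -> differentiable G (x + s *: v').
    move=> sh; apply: differentiableB; last by apply: df; exact: sf0.
    apply: (@differentiable_comp _ _ _ _ (fun z => z + h *: w') f) => //.
    by apply: df; exact: sf.
  have [s sh GE] := MVT_line h0 dG.
  have [|t th DE] := @MVT_line _ (fun y => 'D_v' f y) (x + s *: v') w' h h0.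
    move=> t th; apply: smooth_near_differentiable.
    by apply: smooth_near_derive; exact: sf.
  exists s, t; split=> //; rewrite DE0 -DE.
  have <- : 'D_v' G (x + s *: v') =
      'D_v' f (x + s *: v' + h *: w') - 'D_v' f (x + s *: v').
    rewrite /G deriveB; first last.
    - by apply: diff_derivable; apply: df; exact: sf0.
    - apply: diff_derivable.
      apply: (@differentiable_comp _ _ _ _ (fun z => z + h *: w') f) => //.
      by apply: df; exact: sf.
    congr (_ - _); exact: derive_translate.
  by rewrite -GE /G; ring.
move=> sf.
set A := fun y => 'D_v (fun y => 'D_w f y) y.
set B := fun y => 'D_w (fun y => 'D_v f y) y.
have cA : {for x, continuous A}.
  by apply: smooth_near_continuous; do 2!apply: smooth_near_derive.
have cB : {for x, continuous B}.
  by apply: smooth_near_continuous; do 2!apply: smooth_near_derive.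
rewrite -[LHS]/(A x) -[RHS]/(B x).
have sqB h := square v w B h (fun=> erefl).
have sqA h := square w v A h (fun=> erefl).
clearbody A B; clear square.
apply/eqP; rewrite -subr_eq0.
rewrite -normr_le0; apply/ler_addgt0Pl => e e0; rewrite addr0.
have e20 : 0 < e / 2 by rewrite divr_gt0.
have cA' : \forall y \near x, `|A x - A y| <= e / 2.
  by have /cvgrPdist_le cA0 := cA; exact: cA0 _ e20.
have cB' : \forall y \near x, `|B x - B y| <= e / 2.
  by have /cvgrPdist_le cB0 := cB; exact: cB0 _ e20.
have FF := nbhs_filter x.
have xP := @filterI _ _ FF _ _
  (@filterI _ _ FF _ _ (smooth_near_near sf) cA') cB'.
have [d /= d0 dP] := (nbhs_ballP _ _).1 xP.
(* Points of the square with side [h] are within [d / 2] of [x]; the summand [1] keeps the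
   denominator positive when [v] and [w] vanish. *)
pose h := d / (`|v| + `|w| + 1) / 2.
have k0 : 0 < `|v| + `|w| + 1 by rewrite ltr_wpDl // addr_ge0.
have h0 : 0 < h by rewrite !divr_gt0.
have inb s t : 0 <= s <= h -> 0 <= t <= h -> ball x d (x + s *: v + t *: w).
  move=> /andP[s0 sh] /andP[t0 th]; rewrite -ball_normE /ball_ /=.
  rewrite -addrA opprD addrA subrr add0r normrN.
  apply: (le_lt_trans (ler_normD _ _)); rewrite !normrZ !ger0_norm //.
  apply: (@le_lt_trans _ _ (h * (`|v| + `|w| + 1))).
    rewrite !mulrDr mulr1; apply: ler_wpDr; first exact: ltW.
    by apply: lerD; exact: ler_wpM2r.
  rewrite /h mulrAC divfK ?gt_eqF // ltr_pdivrMr // ltr_pMr // ltr1n //.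
have [s [t [sh th E1]]] := sqB h h0 (fun s t sh th =>
  (dP _ (inb s t sh th)).1.1).
have [s' [t' [sh' th' E2]]] : exists s t, [/\ 0 <= s <= h, 0 <= t <= h &
      f (x + h *: w + h *: v) - f (x + h *: v) - (f (x + h *: w) - f x) =
      A (x + t *: v + s *: w) * h * h].
  have [|s' [t' [sh' th' E2]]] := sqA h h0.
    move=> s' t' sh' th'; rewrite addrAC.
    exact: (dP _ (inb t' s' th' sh')).1.1.
  exists s', t'; split; [exact: sh'|exact: th'|].
  by rewrite [X in A X]addrAC; exact: E2.
(* Both expressions of the same second difference are divided by [h] twice: the two mixed
   derivatives coincide at two points near [x], and continuity does the rest. *)
have E : B (x + s *: v + t *: w) = A (x + t' *: v + s' *: w).
  have hN0 : h != 0 by rewrite gt_eqF.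
  apply: (mulIf hN0); apply: (mulIf hN0); rewrite -E2 -E1.
  by rewrite (addrAC x) !opprB !addrA [in RHS]addrAC; ring.
have [_ B1] := dP _ (inb s t sh th).
have [[_ A1] _] := dP _ (inb t' s' th' sh').
rewrite (splitr e) -(subrKA (A (x + t' *: v + s' *: w))) (le_trans (ler_normD _ _))//.
by apply: lerD => //; rewrite -E distrC.
Unshelve. all: by end_near. Qed.

End Schwarz.

(** * Iterated derivatives *)

Section IterDerive.
Context {R : realType}.

(** Entry by entry, as the mean value theorem is about scalar functions. *)
Lemma schwarz_mx (V : normedModType R) (p q : nat) (f : V -> 'M[R]_(p, q))
    (x v w : V) :
  smooth_near x f -> 'D_v (fun y => 'D_w f y) x = 'D_w (fun y => 'D_v f y) x.
Proof.
move=> sf; apply/matrixP => i j.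
have cL : continuous (fun M : 'M[R]_(p, q) => M i j) := @coord_continuous R p q i j.
have E u u' : ('D_u (fun y => 'D_u' f y) x) i j =
    'D_u (fun y => 'D_u' (fun z => f z i j) y) x.
  have d := smooth_near_differentiable (smooth_near_derive u' sf).
  rewrite -(linear_derive u (@coord_linear R p q i j) cL d).
  apply: near_eq_derive.
  apply: filterS (smooth_near_near sf) => y /smooth_near_differentiable dy.
  by rewrite (linear_derive u' (@coord_linear R p q i j) cL dy).
apply: etrans (E v w) (etrans _ (esym (E w v))).
exact: (schwarz_scalar v w (smooth_near_coord i j sf)).
Qed.

Lemma smooth_near_iter (V W : normedModType R) (f : V -> W) x s :
  smooth_near x f -> smooth_near x (iter_derive s f).
Proof. by move=> sf; elim: s => [|v s IH] //=; exact: smooth_near_derive. Qed.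

(** The innermost derivative is moved outwards past the whole list, one exchange at a time. *)
Lemma iter_derive_rot (V : normedModType R) (p q : nat)
    (f : V -> 'M[R]_(p, q)) x v s :
  smooth_near x f ->
  \forall y \near x, iter_derive s (fun z => 'D_v f z) y = 'D_v (iter_derive s f) y.
Proof.
move=> sf; elim: s => [|u s IH]; first by near=> y.
apply: filterS2 (near_eq_derive_near u IH) (smooth_near_near sf) => y /= -> sfy.
by rewrite schwarz_mx//; exact: smooth_near_iter.
Unshelve. all: by end_near. Qed.

Lemma iter_derive_cat (V W : normedModType R) (f : V -> W) s1 s2 :
  iter_derive (s1 ++ s2) f = iter_derive s1 (iter_derive s2 f).
Proof. by rewrite /iter_derive foldr_cat. Qed.

Lemma iter_derive_perm (V : normedModType R) (I : eqType) (e : I -> V)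
    (p q : nat) (f : V -> 'M[R]_(p, q)) x (s s' : seq I) :
  smooth_near x f -> perm_eq s s' ->
  \forall y \near x, iter_derive (map e s) f y = iter_derive (map e s') f y.
Proof.
move=> sf; elim: s s' => [|v s IH] s' ss'.
  by move: ss'; rewrite perm_sym => /perm_nilP ->; near=> y.
have vs' : v \in s' by rewrite -(perm_mem ss') mem_head.
(* The head of [s] is located in [s'] and its derivative is moved to the front past [s1]; what
   remains is a permutation of the tail. *)
case/splitPr: vs' ss' => s1 s2.
rewrite perm_sym -cat1s perm_catCA /= perm_cons perm_sym => ss'.
have {}IH := near_eq_derive_near (e v) (IH _ ss').
have := iter_derive_rot (e v) (map e s1) (smooth_near_iter (map e s2) sf).
apply: filterS2 IH => y /= -> E.
by rewrite !map_cat !iter_derive_cat /= E.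
Unshelve. all: by end_near. Qed.

Lemma iter_derive_linear (V W W' : normedModType R) (L : W -> W') (f : V -> W)
    x s :
  linear L -> continuous L -> smooth_near x f ->
  \forall y \near x, iter_derive s (fun z => L (f z)) y = L (iter_derive s f y).
Proof.
move=> lL cL sf; elim: s => [|v s IH]; first by near=> y.
apply: filterS2 (near_eq_derive_near v IH) (smooth_near_near sf) => y /= -> sfy.
apply: (linear_derive v lL cL).
by apply: smooth_near_differentiable; exact: smooth_near_iter.
Unshelve. all: by end_near. Qed.

Lemma scale_linear (V : lmodType R) (c : R) : linear ( *:%R c : V -> V).
Proof. by move=> k u v; rewrite scalerDr !scalerA mulrC. Qed.

Lemma iter_derive0 (V W : normedModType R) (x : V) s :
  iter_derive s (fun _ : V => 0 : W) x = 0.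
Proof.
elim: s x => [|v s IH] x //=.
by rewrite (_ : iter_derive s _ = fun=> 0) ?derive_cst//; apply/funext.
Qed.

Lemma iter_derive_add (V W : normedModType R) (f g : V -> W) x s :
  smooth_near x f -> smooth_near x g ->
  \forall y \near x,
    iter_derive s (fun z => f z + g z) y = iter_derive s f y + iter_derive s g y.
Proof.
move=> sf sg; elim: s => [|v s IH]; first by near=> y.
have := derive_add_near v (smooth_near_iter s sf) (smooth_near_iter s sg).
by apply: filterS2 (near_eq_derive_near v IH) => y /= ->.
Unshelve. all: by end_near. Qed.

Lemma iter_derive_sum (V W : normedModType R) (I : Type) (t : seq I)
    (f : I -> V -> W) x s :
  (forall i, smooth_near x (f i)) ->
  iter_derive s (fun z => \sum_(i <- t) f i z) x =
  \sum_(i <- t) iter_derive s (f i) x.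
Proof.
move=> sf; elim: t => [|i t IH].
  rewrite big_nil -[RHS](iter_derive0 W x s); congr (iter_derive s _ x).
  by apply/funext => y; rewrite big_nil.
rewrite big_cons -IH.
have := iter_derive_add s (sf i) (smooth_near_sum t (P := xpredT)
   (f := f) (fun i _ => sf i)).
move=> /nbhs_singleton <-; congr (iter_derive s _ x).
by apply/funext => y; rewrite big_cons.
Qed.

(** The list must be nonempty because the constant [c] disappears only after one derivative. *)
Lemma iter_derive_translate (V W : normedModType R) (f : V -> W) (a : V) (c : W)
    (x : V) s : s != [::] ->
  iter_derive s (fun z => f (a + z) + c) x = iter_derive s f (a + x).
Proof.
have D (h : V -> W) (c' : W) y v : 'D_v (fun z => h (a + z) + c') y = 'D_v h (a + y).
  rewrite /derive.
  have -> // : (fun t : R => t^-1 *: (((fun z => h (a + z) + c') \o shift y) (t *: v)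
      - (h (a + y) + c'))) =
    (fun t : R => t^-1 *: ((h \o shift (a + y)) (t *: v) - h (a + y))).
  apply/funext => t; rewrite /= opprD addrACA subrr addr0.
  by rewrite addrCA.
case: s => [//|v s] _; elim: s v x => [|u s IH] v x; first exact: D.
(* The constant is now [0]: the inner derivatives have already removed [c]. *)
apply: etrans (D (iter_derive (u :: s) f) 0 x v).
rewrite [LHS]/=; congr (derive _ x v); apply/funext => y.
by rewrite addr0 -IH.
Qed.

Definition basis n (j : 'I_n) : 'rV[R]_n := delta_mx 0 j.

(** Each ['D_v] is a combination of the basis derivatives with constant coefficients. The innermost
    direction is expanded first, to fit [agreeS]. *)
Lemma agree_basis (W : normedModType R) n r (f g : 'rV[R]_n -> W) x :
  smooth_near x f -> smooth_near x g ->
  (forall s : seq 'I_n, (size s <= r)%N ->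
    iter_derive (map (@basis n) s) f x = iter_derive (map (@basis n) s) g x) ->
  agree_to_order r x f g.
Proof.
elim: r f g => [|r IH] f g sf sg fg.
  by case=> [|//] _; exact: (fg [::]).
apply/agreeS; split; first exact: (fg [::]).
move=> v.
have E h : smooth_near x h -> \forall y \near x,
    'D_v h y = \sum_(j < n) (fun=> v 0 j) y *: ('D_(basis j) h y : W).
  move=> /smooth_near_near; apply: filterS => y.
  move=> /smooth_near_differentiable dh.
  by rewrite deriveE// diff_delta// big_ord1.
apply: (agree_near2 (E _ sf) (E _ sg)); apply: agree_sum => j.
- by apply: smooth_near_scale; [exact: smooth_near_cst|exact: smooth_near_derive].
- by apply: smooth_near_scale; [exact: smooth_near_cst|exact: smooth_near_derive].
apply: agree_scale; try exact: smooth_near_cst; try exact: smooth_near_derive.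
  exact: agree_refl.
apply: IH; try exact: smooth_near_derive.
move=> s sr; have := fg (rcons s j); rewrite size_rcons => /(_ sr).
by rewrite !map_rcons /iter_derive !foldr_rcons.
Qed.

End IterDerive.

(** * Derivatives of monomials at the origin *)

Section Taylor.
Context {R : realType} (n : nat).
Implicit Types (al : 'I_n -> nat) (x : 'rV[R]_n).

Definition monomial al x : R := \prod_(i < n) x ord0 i ^+ al i.

Lemma smooth_near_prod (V : normedModType R) (I : Type) (t : seq I)
    (P : pred I) (f : I -> V -> R) (x : V) :
  (forall i, smooth_near x (f i)) ->
  smooth_near x (fun y => \prod_(i <- t | P i) f i y).
Proof.
move=> sf; elim: t => [|i t IH].
  by apply: smooth_near_ext (smooth_near_cst (1 : R) x); near=> y; rewrite big_nil.
case Pi : (P i).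
  apply: smooth_near_ext (smooth_near_scale (sf i) IH).
  by near=> y; rewrite big_cons Pi.
by apply: smooth_near_ext IH; near=> y; rewrite big_cons Pi.
Unshelve. all: by end_near. Qed.

Lemma smooth_near_monomial al x : smooth_near x (monomial al).
Proof.
apply: smooth_near_prod => i.
have sc : smooth_near x (fun y : 'rV[R]_n => y ord0 i).
  exact: (smooth_near_coord (f := id) _ _ (smooth_near_id x)).
elim: (al i) => [|k IH]; first exact: smooth_near_cst.
apply: smooth_near_ext (smooth_near_scale sc IH).
by near=> y; rewrite exprS.
Unshelve. all: by end_near. Qed.

(** A directional derivative sees only the values on one line, so in a monomial the coordinates
    other than the varying one may be frozen. *)
Lemma derive_line_ext (V W : normedModType R) (f g : V -> W) (y v : V) :
  (forall t, f (t *: v + y) = g (t *: v + y)) -> 'D_v f y = 'D_v g y.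
Proof.
move=> fg; rewrite /derive.
have fgy : f y = g y by have := fg 0; rewrite scale0r add0r.
have -> // : (fun t : R => t^-1 *: ((f \o shift y) (t *: v) - f y)) =
  (fun t : R => t^-1 *: ((g \o shift y) (t *: v) - g y)).
by apply/funext => t /=; rewrite fg fgy.
Qed.

Lemma derive_monomial al j x :
  'D_(basis j) (monomial al) x =
  (al j)%:R * monomial (fun i => if i == j then (al i).-1 else al i) x.
Proof.
pose c := \prod_(i < n | i != j) x ord0 i ^+ al i.
have E y : monomial al y = y ord0 j ^+ al j * \prod_(i < n | i != j) y ord0 i ^+ al i.
  by rewrite /monomial (bigD1 j).
have dj : is_derive x (basis j) (fun y : 'rV[R]_n => y ord0 j) 1.
  have d := @differentiable_coord R 1 n x ord0 j.
  apply: DeriveDef; first exact: diff_derivable.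
  have := linear_derive (f := id) (basis j) (@coord_linear R 1 n ord0 j)
    (@coord_continuous R 1 n ord0 j) (smooth_near_differentiable (smooth_near_id x)).
  by rewrite /= derive_id mxE !eqxx.
rewrite (derive_line_ext (g := fun y : 'rV[R]_n => c * y ord0 j ^+ al j)); last first.
  move=> t; rewrite E mulrC; congr (_ * _); apply: eq_bigr => i ij.
  by rewrite !mxE /= (negbTE ij) mulr0 add0r.
rewrite /monomial (bigD1 j) //= eqxx.
rewrite (_ : \prod_(i < n | _) _ = c); last first.
  by apply: eq_bigr => i /negbTE ->.
case: (al j) => [|k].
  rewrite mul0r (_ : (fun y => _) = cst c) ?derive_cst//.
  by apply/funext => y; rewrite expr0 mulr1.
have -> : (fun y : 'rV[R]_n => c * y ord0 j ^+ k.+1) =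
    c *: ((fun y : 'rV[R]_n => y ord0 j) ^+ k.+1).
  by apply/funext => y; rewrite fctE.
rewrite deriveZ; last exact: ex_derive.
by rewrite derive_val /= /GRing.scale /= mulr1 mulrC mulrA.
Qed.

Lemma iter_derive_monomial (s : seq 'I_n) al :
  iter_derive (map (@basis R n) s) (monomial al) 0 =
  if [forall i, al i == count_mem i s] then \prod_(i < n) ((al i)`!)%:R else 0.
Proof.
elim/last_ind: s al => [|s j IH] al.
  rewrite /= /monomial; case: ifPn => [/forallP al0|].
    by apply: eq_bigr => i _; rewrite mxE (eqP (al0 i)).
  rewrite negb_forall => /existsP[i ali].
  by rewrite (bigD1 i) //= mxE expr0n (negbTE ali) mul0r.
rewrite map_rcons /iter_derive foldr_rcons -/(iter_derive _ _).
have -> : (fun x => 'D_(basis j) (monomial al) x) =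
    (fun x => (al j)%:R *
      monomial (fun i => if i == j then (al i).-1 else al i) x).
  by apply/funext => x; exact: derive_monomial.
have /nbhs_singleton -> := iter_derive_linear (L := *:%R (al j)%:R)
   (map (@basis R n) s) (@scale_linear _ _ _) (@scaler_continuous _ _ _)
   (smooth_near_monomial (fun i => if i == j then (al i).-1 else al i) 0).
(* If [al j = 0] the derivative vanishes, whatever the truncated predecessor is; the right side
   vanishes too, since [j] occurs in the list. *)
rewrite IH /=; case: (posnP (al j)) => [al0|al0].
  rewrite al0 scale0r; case: ifPn => // /forallP/(_ j).
  by rewrite al0 -cats1 count_cat /= eqxx addnC.
have -> : [forall i, (if i == j then (al i).-1 else al i) == count_mem i s] =
    [forall i, al i == count_mem i (rcons s j)].
  apply: eq_forallb => i; rewrite -cats1 count_cat /= addn0 (eq_sym j).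
  have [->|_] := eqVneq i j; last by rewrite addn0.
  by rewrite -eqSS prednK // addn1.
case: ifP => _; last by rewrite scaler0.
rewrite (bigD1 j) //= [RHS](bigD1 j) //= eqxx /GRing.scale /= mulrA.
congr (_ * _); first by rewrite -natrM -{1}(prednK al0) -factS prednK.
by apply: eq_bigr => i /negbTE ->.
Qed.

End Taylor.

(** * Taylor polynomials *)

Section TaylorPolynomial.
Context {R : realType} (n r : nat).

(** The ordering of the partial derivatives chosen to represent the multi-index. *)
Definition mindex_seq (al : mindex n r) : seq 'I_n :=
  flatten [seq nseq (val al i) i | i <- enum 'I_n].

Lemma count_mindex_seq (al : mindex n r) i : count_mem i (mindex_seq al) = val al i.
Proof.
rewrite /mindex_seq count_flatten -map_comp sumnE big_map big_enum /=.
rewrite (bigD1 i) //= count_nseq /= eqxx mul1n big1 ?addn0 // => j ji.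
by rewrite count_nseq /= (negbTE ji).
Qed.

Lemma sum_count_mem (s : seq 'I_n) : (\sum_i count_mem i s = size s)%N.
Proof.
elim: s => [|j s IH] /=; first by rewrite big1.
rewrite big_split /= IH (bigD1 j) //= eqxx big1 ?addn0 // => i.
by rewrite eq_sym => /negbTE ->.
Qed.

Lemma smooth_near_translate (W : normedModType R) (h : 'rV[R]_n -> W) (c : W) y :
  smooth_near y h -> smooth_near 0 (fun t => h (y + t) + c).
Proof.
move=> sh; apply: smooth_near_add; last exact: smooth_near_cst.
apply: (smooth_near_comp (f := fun t => y + t) (F := h)).
  by apply: smooth_near_add; [exact: smooth_near_cst|exact: smooth_near_id].
by rewrite addr0.
Qed.

(** The usual coefficients, derivatives of order [al] divided by the factorial of [al].
    Multi-indices have order at least one, so there is no constant term and [taylor] subtracts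
    [h y]. *)
Definition taylor_coeffs (h : 'rV[R]_n -> 'rV[R]_n) (y : 'rV[R]_n) :
    jet_coeffs R n r :=
  \matrix_(k, j) let al := enum_val k : mindex n r in
    (\prod_i ((val al i)`!)%:R)^-1 *
    iter_derive (map (@basis R n) (mindex_seq al)) h y ord0 j.

Lemma smooth_near_poly_map (a : jet_coeffs R n r) x : smooth_near x (poly_map a).
Proof.
apply: smooth_near_sum => al _; apply: smooth_near_scale.
  exact: smooth_near_monomial.
exact: smooth_near_cst.
Qed.

(** At the origin only the monomial whose exponents are the multiplicities in [s] survives, so the
    sum has at most one term. *)
Lemma iter_derive_poly_map (a : jet_coeffs R n r) (s : seq 'I_n) :
  iter_derive (map (@basis R n) s) (poly_map a) 0 =
  \sum_(al : mindex n r | [forall i, (val al i : nat) == count_mem i s])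
    (\prod_i ((val al i)`!)%:R) *: row (enum_rank al) a.
Proof.
have sm (al : mindex n r) : smooth_near 0
    (fun x : 'rV[R]_n => monomial (fun i => val al i) x *: row (enum_rank al) a).
  apply: smooth_near_scale; first exact: smooth_near_monomial.
  exact: smooth_near_cst.
rewrite [LHS](iter_derive_sum _ _ sm) [RHS]big_mkcond /=.
apply: eq_bigr => al _.
have lL : linear (fun k : R => k *: row (enum_rank al) a).
  by move=> k u v; rewrite scalerDl scalerA.
have /nbhs_singleton -> := iter_derive_linear (map (@basis R n) s) lL
  (@scalel_continuous _ _ _) (smooth_near_monomial (fun i => val al i) 0).
by rewrite iter_derive_monomial; case: ifP; rewrite ?scale0r.
Qed.

Lemma poly_map0 (a : jet_coeffs R n r) : poly_map a 0 = 0.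
Proof.
rewrite -[LHS]/(iter_derive (map (@basis R n) [::]) (poly_map a) 0).
rewrite iter_derive_poly_map big1// => al /forallP al0.
have /andP[+ _] := valP al; rewrite big1// => i _.
exact/eqP/al0.
Qed.

Lemma taylor (h : 'rV[R]_n -> 'rV[R]_n) (y : 'rV[R]_n) :
  smooth_near y h ->
  agree_to_order r 0 (fun t => h (y + t) - h y) (poly_map (taylor_coeffs h y)).
Proof.
move=> sh; apply: agree_basis.
- exact: smooth_near_translate.
- exact: smooth_near_poly_map.
case=> [|j s] sr; first by rewrite /= poly_map0 addr0 subrr.
rewrite iter_derive_translate// addr0 iter_derive_poly_map.
set t := j :: s in sr *.
have tr i : (count_mem i t < r.+1)%N by rewrite ltnS (leq_trans (count_size _ _)).
(* The multi-index of the multiplicities in the list, whose order is the length of the list: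
   positive as the list is nonempty, and at most [r]. It is the one surviving term. *)
pose f := [ffun i => Ordinal (tr i)].
have sumE : (\sum_i f i = size t)%N.
  by rewrite -[RHS]sum_count_mem; apply: eq_bigr => i _; rewrite ffunE.
have fP : (0 < \sum_i f i <= r)%N by rewrite sumE sr.
pose al : mindex n r := exist _ f fP.
rewrite (big_pred1 al) => [|be]; last first.
  apply/forallP/eqP => [E|-> i]; last by rewrite /= ffunE.
  by apply/val_inj/ffunP => i; apply/val_inj; rewrite /= ffunE /=; exact/eqP/E.
apply/rowP => k; rewrite !mxE enum_rankK mulrA divff ?mul1r; last first.
  by apply/prodf_neq0 => i _; rewrite pnatr_eq0 -lt0n fact_gt0.
(* The list at hand and the one chosen for the coefficient differ by a permutation, which symmetry
   of derivatives absorbs. *)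
have tal : perm_eq t (mindex_seq al).
  by apply/allP => i _; rewrite /= count_mindex_seq /= ffunE.
by have /nbhs_singleton -> := iter_derive_perm (@basis R n) sh tal.
Qed.

Lemma smooth_on_taylor_coeffs (U : set 'rV[R]_n) (h : 'rV[R]_n -> 'rV[R]_n) :
  open U -> smooth_on U h -> smooth_on U (taylor_coeffs h).
Proof.
move=> oU sh k; apply: Ck_mx => // i j.
pose c : R := (\prod_l ((val (enum_val i : mindex n r) l)`!)%:R)^-1.
pose s := map (@basis R n) (mindex_seq (enum_val i)).
have E x : U x -> c * iter_derive s h x ord0 j = taylor_coeffs h x i j.
  by rewrite mxE.
apply: (Ck_ext oU E); apply: Ck_scale => //; first exact: Ck_cst.
apply: Ck_coord => //.
suff : smooth_on U (iter_derive s h) by exact.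
by clear E; elim: s => [|v s IH] //=; exact: smooth_on_derive.
Qed.

End TaylorPolynomial.

(** * Inverses of jets *)

Section LocalMaps.
Context {R : realType} (n : nat).
Implicit Types f g F G : 'rV[R]_n -> 'rV[R]_n.

(** Representatives of the elements of the jet group, freed of charts and classes. *)
Definition local_iso f : Prop :=
  [/\ smooth_near 0 f, f 0 = 0 & bijective ('d f 0)].

Lemma linear_inj_bij (L : {linear 'rV[R]_n -> 'rV[R]_n}) :
  injective L -> bijective L.
Proof.
move=> Linj.
have LE v : L v = v *m lin1_mx L by rewrite mul_rV_lin1.
have LU : lin1_mx L \in unitmx.
  rewrite -row_free_unit; apply: inj_row_free => v.
  by rewrite -LE => Lv; apply: Linj; rewrite Lv linear0.
exists (mulmx^~ (invmx (lin1_mx L))) => v; rewrite LE.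
  by rewrite mulmxK.
by rewrite mulmxKV.
Qed.

Lemma smooth_near_lin (L : 'rV[R]_n -> 'rV[R]_n) x : linear L -> smooth_near x L.
Proof.
move=> lL.
have -> : L = fun v => \sum_(j < n) v 0 j *: L (basis j).
  apply/funext => v; rewrite -[L]/(pack_linear lL : _ -> _).
  rewrite {1}(row_sum_delta v) linear_sum; apply: eq_bigr => j _.
  by rewrite linearZ.
apply: smooth_near_sum => j _; apply: smooth_near_scale.
  exact: (smooth_near_coord (f := id) _ _ (smooth_near_id x)).
exact: smooth_near_cst.
Qed.

Lemma agree1_diff f : smooth_near 0 f -> agree_to_order 1 0 f id ->
  'd f 0 = id :> ('rV[R]_n -> 'rV[R]_n).
Proof.
move=> sf /agreeS[_ Df]; apply/funext => v.
rewrite -deriveE; last exact: smooth_near_differentiable.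
by have /agree0 -> := Df v; rewrite derive_id.
Qed.

Lemma local_iso_id : local_iso id.
Proof.
split=> //; first exact: smooth_near_id.
rewrite (agree1_diff (smooth_near_id _) (@agree_refl _ _ _ _ _ _)).
by exists id.
Qed.

Lemma local_iso_comp f g : local_iso f -> local_iso g -> local_iso (f \o g).
Proof.
move=> [sf f0 bf] [sg g0 bg].
have sf' : smooth_near (g 0) f by rewrite g0.
split; [exact: smooth_near_comp|by rewrite /= g0|].
rewrite diff_comp; [|exact: smooth_near_differentiable..].
have bf' : bijective ('d f (g 0)).
  rewrite g0; exact: bf.
exact: (bij_comp bf' bg).
Qed.

(** The induction starts at order one, where [G = id] serves. Tangency of [G] to the identity is
    carried along, as it makes [G] a local isomorphism. *)
Lemma agree1_right_inverse r F : smooth_near 0 F -> agree_to_order 1 0 F id ->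
  exists G, [/\ smooth_near 0 G, agree_to_order 1 0 G id &
    agree_to_order r.+1 0 (F \o G) id].
Proof.
move=> sF F1; elim: r => [|r [G [sG G1 FG]]].
  by exists id; split; [exact: smooth_near_id|exact: agree_refl|].
have G0 := agree0 G1; rewrite /= in G0.
have sFG : smooth_near 0 (F \o G) by apply: smooth_near_comp; rewrite ?G0.
have sN : smooth_near 0 (fun t : 'rV[R]_n => - t).
  apply: smooth_near_lin => k u v.
  by rewrite opprD scalerN.
pose e t := (F \o G) t - t.
have se : smooth_near 0 e by exact: smooth_near_add.
have e0 : agree_to_order r.+1 0 e (fun=> 0).
  have := agree_add sFG (smooth_near_id _) sN sN FG (@agree_refl _ _ _ _ _ _).
  move=> H; apply: agree_trans H _; apply: agree_near; near=> t.
  exact: subrr.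
pose psi t : 'rV[R]_n := t - e t.
have sNe : smooth_near 0 (fun t => - e t).
  apply: (smooth_near_comp (f := e) (F := fun t => - t)) => //.
  by rewrite (agree0 e0).
have spsi : smooth_near 0 psi.
  by apply: smooth_near_add => //; exact: smooth_near_id.
have Ne0 k : agree_to_order k 0 e (fun=> 0) ->
    agree_to_order k 0 (fun t => - e t) (fun=> 0).
  move=> ek.
  have lN : linear (fun t : 'rV[R]_n => - t) by move=> c u v; rewrite opprD scalerN.
  have cN : continuous (fun t : 'rV[R]_n => - t) by exact: opp_continuous.
  have := agree_linear lN cN se (smooth_near_cst 0 _) ek.
  by move=> H; apply: agree_trans H _; apply: agree_near; near=> t; rewrite oppr0.
have psi1 : agree_to_order 1 0 psi id.
  have := agree_add (smooth_near_id 0) (smooth_near_id 0) sNe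
    (smooth_near_cst 0 _) (@agree_refl _ _ _ _ _ _)
    (Ne0 1%N (agree_le (ltn0Sn r) e0)).
  by move=> H; apply: agree_trans H _; apply: agree_near; near=> t; rewrite addr0.
have psi0 : psi 0 = 0 by exact: agree0 psi1.
have sG' : smooth_near (psi 0) G by rewrite psi0.
exists (G \o psi); split.
- exact: smooth_near_comp.
- apply: (@agree_trans _ _ _ _ _ _ (id \o psi)); last exact: psi1.
  apply: agree_comp => //; rewrite ?psi0 //.
  exact: smooth_near_id.
have sepsi : smooth_near 0 (e \o psi) by apply: smooth_near_comp; rewrite ?psi0.
(* [F \o G \o psi] is [psi + e \o psi]; replacing [e \o psi] by [e] is correct to one order more,
   and [psi + e] is the identity. *)
have := agree_add spsi spsi sepsi se (@agree_refl _ _ _ r.+2 _ _)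
  (agree_flat_comp spsi se psi1 e0).
apply: agree_near2; near=> t.
  by rewrite /= /e /= [psi t + _]addrC subrK.
by rewrite /psi subrK.
Unshelve. all: by end_near. Qed.

Lemma local_iso_right_inverse r F : local_iso F ->
  exists2 G, local_iso G & agree_to_order r 0 (F \o G) id.
Proof.
move=> [sF F0 [L FL LF]].
(* [L] inverts the differential of [F] at [0], so that [F \o L] is tangent to the identity. *)
have lL : linear L.
  move=> k u v; by apply: (can_inj FL); rewrite linearP !LF.
have L0 : L 0 = 0 by rewrite -[L]/(pack_linear lL : _ -> _) linear0.
have sL x : smooth_near x L := smooth_near_lin x lL.
have cL : continuous L by move=> x; exact: smooth_near_continuous.
have dF : differentiable F (L 0) by rewrite L0; exact: smooth_near_differentiable.
have sFL : smooth_near 0 (F \o L) by apply: smooth_near_comp; rewrite ?L0.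
have dL : 'd L 0 = L :> (_ -> _) := @diff_lin _ _ _ (pack_linear lL) 0 cL.
have FL1 : agree_to_order 1 0 (F \o L) id.
  apply/agreeS; split; first by rewrite /= L0.
  move=> v s; rewrite leqn0 => /nilP ->; rewrite [RHS]derive_id [LHS]/iter_derive [LHS]/=.
  rewrite deriveE; last exact: smooth_near_differentiable.
  rewrite diff_comp //; last exact: smooth_near_differentiable.
  rewrite L0; apply: etrans (LF v).
  exact: (congr1 (fun h : _ -> _ => 'd F 0 (h v)) dL).
have [G [sG G1 FG]] := agree1_right_inverse r sFL FL1.
have G0 : G 0 = 0 := agree0 G1.
exists (L \o G); last exact: (agree_le (leqnSn r) FG).
apply: local_iso_comp; split => //.
  by rewrite dL; exists ('d F 0).
by rewrite agree1_diff//; exists id.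
Qed.

Lemma agree_comp0 (W : normedModType R) r f f' (F F' : 'rV[R]_n -> W) :
  smooth_near 0 f -> smooth_near 0 f' -> f 0 = 0 ->
  smooth_near 0 F -> smooth_near 0 F' ->
  agree_to_order r 0 f f' -> agree_to_order r 0 F F' ->
  agree_to_order r 0 (F \o f) (F' \o f').
Proof.
move=> sf sf' f0 sF sF'; have := @agree_comp R _ W _ _ r f f' F F' 0.
by rewrite f0; exact.
Qed.

Lemma local_iso_inverse r F : local_iso F ->
  exists G, [/\ local_iso G, agree_to_order r 0 (F \o G) id &
    agree_to_order r 0 (G \o F) id].
Proof.
move=> iF; have [G iG FG] := local_iso_right_inverse r iF.
(* As in a group: if [G] has the right inverse [H], then [F] agrees with [F \o G \o H], hence with
   [H], and [G \o F] agrees with [G \o H]. *)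
have [H iH GH] := local_iso_right_inverse r iG.
exists G; split=> //.
have [[sF F0 _] [sG G0 _] [sH H0 _]] := And3 iF iG iH.
have [[sFG FG0 _] [sGH GH0 _]] := (local_iso_comp iF iG, local_iso_comp iG iH).
have FH : agree_to_order r 0 F H.
  have E1 := agree_comp0 sGH (smooth_near_id 0) GH0 sF sF GH (agree_refl 0 F).
  have E2 := agree_comp0 sH sH H0 sFG (smooth_near_id 0) (agree_refl 0 H) FG.
  exact: (agree_trans (agree_sym E1) E2).
exact: (agree_trans (agree_comp0 sF sH F0 sG sG FH (agree_refl 0 G)) GH).
Qed.

End LocalMaps.

(** * Jets of maps into manifolds *)

Section Jets.
Context {R : realType} (n r : nat) (E : normedModType R) (X : charted E).
Implicit Types xi eta : 'rV[R]_n -> X.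

Lemma smooth0P xi : smooth0 xi <->
  forall d, atlas X d -> cdom d (xi 0) ->
    (\forall t \near (0 : 'rV[R]_n), cdom d (xi t)) /\ smooth_near 0 (d \o xi).
Proof.
split=> [sxi d Xd dx|sxi c d /= -> Xd _ dx].
  have [g [sg gE]] := sxi (Chart setT id) d erefl Xd I dx.
  split; first by apply: filterS gE => t /(_ t I erefl)[].
  by apply: smooth_near_ext sg; apply: filterS gE => t /(_ t I erefl)[].
have [dxi sd] := sxi d Xd dx; exists (d \o xi); split => //.
by apply: filterS dxi => t dt x' _ /= ->.
Qed.

Lemma same_jet_refl xi : same_jet r xi xi.
Proof. by split=> // c _ _; exact: agree_refl. Qed.

Lemma same_jet_sym xi eta : same_jet r xi eta -> same_jet r eta xi.
Proof.
move=> [xe H]; split; first by rewrite xe.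
by move=> c Xc cx; apply: agree_sym; apply: H => //; rewrite xe.
Qed.

Lemma same_jet_trans xi eta zeta :
  same_jet r xi eta -> same_jet r eta zeta -> same_jet r xi zeta.
Proof.
move=> [xe H] [ez H']; split; first by rewrite xe.
by move=> c Xc cx; apply: agree_trans (H c Xc cx) _; apply: H' => //; rewrite -xe.
Qed.

Lemma jet_eqP xi eta : smooth0 xi -> smooth0 eta ->
  jet r xi = jet r eta <-> same_jet r xi eta.
Proof.
move=> sxi seta; split=> [je|xe].
  have : jet r eta eta by split=> //; exact: same_jet_refl.
  by rewrite -je => -[].
apply/seteqP; split=> z [sz Hz]; split=> //.
  by apply: same_jet_trans Hz; exact: same_jet_sym.
exact: same_jet_trans Hz.
Qed.

Lemma smooth0_comp xi (f : 'rV[R]_n -> 'rV[R]_n) :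
  smooth0 xi -> smooth_near 0 f -> f 0 = 0 -> smooth0 (xi \o f).
Proof.
move=> /smooth0P sxi sf f0; apply/smooth0P => d Xd; rewrite /= f0 => dx.
have [dxi sd] := sxi d Xd dx; split.
  have cf := smooth_near_continuous sf.
  by apply: (cf (fun t => cdom d (xi t))); rewrite f0.
by apply: (smooth_near_comp (F := d \o xi)) => //; rewrite f0.
Qed.

Lemma same_jet_comp xi eta (f g : 'rV[R]_n -> 'rV[R]_n) :
  smooth0 xi -> smooth0 eta -> smooth_near 0 f -> smooth_near 0 g -> f 0 = 0 ->
  same_jet r xi eta -> agree_to_order r 0 f g ->
  same_jet r (xi \o f) (eta \o g).
Proof.
move=> sxi seta sf sg f0 [xe H] fg.
have g0 : g 0 = 0 by rewrite -(agree0 fg).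
split; first by rewrite /= f0 g0.
move=> c Xc; rewrite /= f0 => cx.
have [_ s1] := (smooth0P xi).1 sxi c Xc cx.
have [_ s2] := (smooth0P eta).1 seta c Xc (eq_ind _ _ cx _ xe).
exact: (agree_comp0 sf sg f0 s1 s2 fg (H c Xc cx)).
Qed.

End Jets.

Section EuclideanJets.
Context {R : realType} (n r : nat).
Implicit Types f g : 'rV[R]_n -> 'rV[R]_n.

Lemma smooth0_euclid f :
  smooth0 (X := euclid 'rV[R]_n) f <-> smooth_near 0 f.
Proof.
split=> [/smooth0P/(_ (Chart setT id) erefl I)[]//|sf].
have fT : \forall t \near (0 : 'rV[R]_n), [set: 'rV[R]_n] (f t).
  by near=> t; exact: I.
by apply/smooth0P => d /= -> _; split; [exact: fT|exact: sf].
Unshelve. all: by end_near. Qed.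

Lemma ejet_eqP f g : smooth_near 0 f -> smooth_near 0 g ->
  ejet r f = ejet r g <-> agree_to_order r 0 f g.
Proof.
move=> sf sg; have sf' := (smooth0_euclid f).2 sf.
have sg' := (smooth0_euclid g).2 sg; apply: (iff_trans (jet_eqP r sf' sg')).
split=> [[_ H]|fg]; first exact: (H (Chart setT id) erefl I).
by split=> [|c /= -> _]; [exact: agree0 fg|exact: fg].
Qed.

Lemma jet_groupP G : jet_group (n := n) r G <->
  exists2 f : 'rV[R]_n -> 'rV[R]_n, local_iso f & G = ejet r f.
Proof.
split=> [[f [[sf bf] f0] <-]|[f [sf f0 bf] ->]].
  exists f => //; split=> //; first exact/smooth0_euclid.
  exact: (bf (Chart setT id) erefl I).
exists f; last reflexivity.
split; last exact: f0.
split; first exact: (smooth0_euclid f).2 sf.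
by move=> c /= -> _; exact: bf.
Qed.

(** [jet_comp] collects the composites of all representatives; since the jet of a composite depends
    only on the two jets, they form a single class. *)
Lemma jet_compE (E : normedModType R) (X : charted E) (xi : 'rV[R]_n -> X) f :
  smooth0 xi -> smooth_near 0 f -> f 0 = 0 ->
  jet_comp r (jet r xi) (ejet r f) = jet r (xi \o f).
Proof.
move=> sxi sf f0; have sxf := smooth0_comp sxi sf f0.
apply/seteqP; split=> eta; last first.
  move=> xfe; exists xi, f; split=> //; split=> //; try exact: same_jet_refl.
  exact/smooth0_euclid.
move=> [xi' [f' [[sxi' xx] [/smooth0_euclid sf' [f0' ff]]]]].
have {}ff : agree_to_order r 0 f f' := ff (Chart setT id) erefl I.
suff -> : jet r (xi' \o f') = jet r (xi \o f) by [].
have f'0 : f' 0 = 0 by rewrite -f0'.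
apply/jet_eqP => //; first exact: smooth0_comp.
by apply: same_jet_sym; exact: same_jet_comp.
Qed.

Lemma ejet_compE f g : smooth_near 0 f -> local_iso g ->
  ejet_comp r (ejet r f) (ejet r g) = ejet r (f \o g).
Proof.
move=> sf [sg g0 _].
exact: (@jet_compE _ (euclid 'rV[R]_n) f g ((smooth0_euclid f).2 sf) sg g0).
Qed.

End EuclideanJets.

(** * Germs into a manifold; the jet group acts freely and transitively on the frames at a point *)

Section Manifold.
Context {R : realType} (n : nat) (M : manifold R n).
Implicit Types (c d : chart M 'rV[R]_n) (x : M) (xi eta : 'rV[R]_n -> M).

(** This is the compatibility of charts. It makes independence of the chart the case [phi = id] of
    statements about transport by [phi]. *)
Lemma smooth_map_id : smooth_map (X := M) (Y := M) id.
Proof.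
move=> x c d Mc Md cx dx /=; have [g sg gE] := mcompatible Mc Md.
have oW : open (c @` (cdom c `&` cdom d)).
  apply: (mopen_map Mc) => [|y []//].
  by apply: openI; apply: mopen.
have Wx : (c @` (cdom c `&` cdom d)) (c x) by exists x.
exists g; split; first by exists (c @` (cdom c `&` cdom d)) => //; split.
apply: (open_near oW _ Wx) => y [z [cz dz] <-] x' cx' czE.
have -> : x' = z by apply: (minj Mc); rewrite ?inE.
by split => //; exact: gE.
Qed.

(** One local expression [h] serves all germs through [x], so two germs can be compared through the
    same [h]. *)
Lemma smooth_local (phi : M -> M) x c d :
  smooth_map (X := M) (Y := M) phi -> matlas M c -> matlas M d -> cdom c x ->
  cdom d (phi x) ->
  exists2 h, smooth_near (c x) h &
    forall xi, smooth0 (X := M) xi -> xi 0 = x ->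
      \forall t \near (0 : 'rV[R]_n),
        cdom d (phi (xi t)) /\ d (phi (xi t)) = h (c (xi t)).
Proof.
move=> sphi Mc Md cx dx; have [h [sh hE]] := sphi x c d Mc Md cx dx.
exists h => // xi sxi xi0.
have cx0 : cdom c (xi 0) by rewrite xi0.
have [cxi sc] := (smooth0P _).1 sxi c Mc cx0.
have cc := smooth_near_continuous sc.
have hE' : \forall t \near (0 : 'rV[R]_n), forall x', cdom c x' -> c x' = (c \o xi) t ->
    cdom d (phi x') /\ d (phi x') = h ((c \o xi) t).
  apply: (cc (fun y => forall x', cdom c x' -> c x' = y ->
    cdom d (phi x') /\ d (phi x') = h y)).
  by rewrite /= xi0.
by apply: filterS2 cxi hE' => t ct; exact.
Qed.

Lemma smooth0_push (phi : M -> M) xi :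
  smooth_map (X := M) (Y := M) phi -> smooth0 (X := M) xi ->
  smooth0 (X := M) (phi \o xi).
Proof.
move=> sphi sxi; apply/smooth0P => d Md dx.
have [c Mc cx] := mcover (xi 0).
have [h sh /(_ xi sxi erefl) hE] := smooth_local sphi Mc Md cx dx.
split; first by apply: filterS hE => t [].
have [_ sc] := (smooth0P _).1 sxi c Mc cx.
apply: (smooth_near_ext _ (smooth_near_comp sc sh)).
by apply: filterS hE => t [_ dt]; exact: esym dt.
Qed.

(** Agreement in a single chart at the source yields agreement in every chart at the target, by
    composing with the local expression of [phi]. *)
Lemma same_jet_push r (phi : M -> M) xi eta c :
  smooth_map (X := M) (Y := M) phi -> smooth0 (X := M) xi ->
  smooth0 (X := M) eta -> matlas M c -> cdom c (xi 0) -> xi 0 = eta 0 ->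
  agree_to_order r 0 (c \o xi) (c \o eta) ->
  same_jet (X := M) r (phi \o xi) (phi \o eta).
Proof.
move=> sphi sxi seta Mc cx xe ce; split; first by rewrite /= xe.
move=> d Md dx.
have [h sh hE] := smooth_local sphi Mc Md cx dx.
have [_ s1] := (smooth0P _).1 sxi c Mc cx.
have [_ s2] := (smooth0P _).1 seta c Mc (eq_ind _ _ cx _ xe).
apply: (@agree_near2 _ _ _ _ _ _ (h \o (c \o xi)) _ (h \o (c \o eta))).
- by apply: filterS (hE xi sxi erefl) => t [].
- by apply: filterS (hE eta seta (esym xe)) => t [].
apply: agree_comp => //; exact: agree_refl.
Qed.

Lemma same_jet_chart r xi eta c :
  smooth0 (X := M) xi -> smooth0 (X := M) eta -> matlas M c -> cdom c (xi 0) ->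
  xi 0 = eta 0 -> agree_to_order r 0 (c \o xi) (c \o eta) ->
  same_jet (X := M) r xi eta.
Proof. exact: same_jet_push smooth_map_id. Qed.

Lemma regular_push (phi psi : M -> M) xi c :
  smooth_map (X := M) (Y := M) phi -> smooth_map (X := M) (Y := M) psi ->
  cancel phi psi -> smooth0 (X := M) xi -> matlas M c -> cdom c (xi 0) ->
  bijective ('d (cmap c \o xi) 0) -> regular (X := M) (phi \o xi).
Proof.
move=> sphi spsi phiK sxi Mc cx bij.
have sphixi := smooth0_push sphi sxi; split; [exact: sphixi|move=> d Md dx].
have [h sh hE] := smooth_local sphi Mc Md cx dx.
have cx' : cdom c (psi (phi (xi 0))) by rewrite phiK.
(* The local expression [k] of [psi] recovers [c \o xi] from [d \o phi \o xi]; the differential of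
   the latter is therefore injective, hence bijective by dimension. *)
have [k sk /(_ _ sphixi erefl) kE] := smooth_local spsi Md Mc dx cx'.
have [_ sd] := (smooth0P _).1 sphixi d Md dx.
apply: linear_inj_bij => u v uv; apply: (bij_inj bij).
have E w : 'd (c \o xi) 0 w = 'd k (d (phi (xi 0))) ('d (d \o (phi \o xi)) 0 w).
  have [_ sc] := (smooth0P _).1 sxi c Mc cx.
  have dc := smooth_near_differentiable sc.
  have dd := smooth_near_differentiable sd.
  have dk := smooth_near_differentiable sk.
  apply: etrans (esym (deriveE w dc)) _.
  apply: etrans (_ : _ = 'D_w (k \o (d \o (phi \o xi))) 0) _.
    apply: near_eq_derive; apply: filterS kE => t [_] /=.
    by rewrite phiK.
  apply: etrans (deriveE w (differentiable_comp dd dk)) _.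
  exact: (congr1 (fun h : _ -> _ => h w) (diff_comp dd dk)).
exact: (etrans (E u) (etrans (congr1 ('d k (d (phi (xi 0)))) uv) (esym (E v)))).
Qed.

Lemma regular_chart xi c :
  smooth0 (X := M) xi -> matlas M c -> cdom c (xi 0) ->
  bijective ('d (cmap c \o xi) 0) -> regular (X := M) xi.
Proof. by apply: (regular_push smooth_map_id smooth_map_id). Qed.

Lemma diffeo_regular (phi psi : M -> M) xi :
  smooth_map (X := M) (Y := M) phi -> smooth_map (X := M) (Y := M) psi ->
  cancel phi psi -> regular (X := M) xi -> regular (X := M) (phi \o xi).
Proof.
move=> sphi spsi phiK [sxi bxi]; have [c Mc cx] := mcover (xi 0).
exact: (regular_push sphi spsi phiK sxi Mc cx (bxi c Mc cx)).
Qed.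

Lemma regular_comp xi (f : 'rV[R]_n -> 'rV[R]_n) :
  regular (X := M) xi -> local_iso f -> regular (X := M) (xi \o f).
Proof.
move=> [sxi bxi] [sf f0 bf]; have sxf := smooth0_comp sxi sf f0.
split; [exact: sxf|move=> c Mc; rewrite /= f0 => cx].
have [_ sc] := (smooth0P _).1 sxi c Mc cx.
have df := smooth_near_differentiable sf.
have dc : differentiable (c \o xi) (f 0).
  by rewrite f0; exact: smooth_near_differentiable sc.
have E : 'd (c \o (xi \o f)) 0 = 'd (c \o xi) (f 0) \o 'd f 0 :> (_ -> _).
  exact: diff_comp df dc.
have bxi' : bijective ('d (c \o xi) (f 0)) by rewrite f0; exact: (bxi c Mc cx).
by rewrite E; exact: (bij_comp bxi' bf).
Qed.

Lemma local_iso_chart xi c : regular (X := M) xi -> matlas M c ->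
  cdom c (xi 0) -> local_iso (fun t => c (xi t) - c (xi 0)).
Proof.
move=> [sxi bxi] Mc cx; have [_ sc] := (smooth0P _).1 sxi c Mc cx.
split; last 1 first.
- have E : 'd (fun t => c (xi t) - c (xi 0)) 0 = 'd (c \o xi) 0 :> (_ -> _).
    apply: etrans (diffB (smooth_near_differentiable sc)
      (differentiable_cst (c (xi 0)) 0)) _.
    have D0 : 'd (cst (c (xi 0))) (0 : 'rV[R]_n) = 0 :> ('rV[R]_n -> 'rV[R]_n).
      exact: diff_cst.
    exact: etrans (congr1 (fun h : 'rV[R]_n -> 'rV[R]_n => 'd (c \o xi) 0 \- h) D0)
      (subr0 _).
  rewrite E; exact: (bxi c Mc cx).
- exact: (smooth_near_add sc (smooth_near_cst _ 0)).
- exact: subrr.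
Qed.

(** Transitivity: in a chart moved to the origin, [f] is the reading of [eta] followed by an
    inverse, up to order [r], of the reading of [xi]. *)
Lemma regular_same_base r xi eta :
  regular (X := M) xi -> regular (X := M) eta -> xi 0 = eta 0 ->
  exists2 f, local_iso f & same_jet (X := M) r eta (xi \o f).
Proof.
move=> rxi reta xe; have [c Mc cx] := mcover (xi 0).
have cx' : cdom c (eta 0) by rewrite -xe.
have iF := local_iso_chart rxi Mc cx; have iF' := local_iso_chart reta Mc cx'.
set F := (fun t => _) in iF; set F' := (fun t => _) in iF'.
have [G [iG FG _]] := local_iso_inverse r iF.
have iGF := local_iso_comp iG iF'.
exists (G \o F') => //.
have [[sF F0 _] [sF' F'0 _]] := (iF, iF').
have [[sG G0 _] [sGF GF0 _]] := (iG, iGF).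
have [[sxi _] [seta _]] := (rxi, reta).
have sxf := smooth0_comp sxi sGF GF0.
apply: same_jet_sym; apply: (same_jet_chart sxf seta Mc); rewrite ?GF0 //=.
- by rewrite F'0 G0.
- by rewrite F'0 G0.
have sFG : smooth_near 0 (F \o G) by apply: smooth_near_comp; rewrite ?G0.
have A := agree_comp0 sF' sF' F'0 sFG (smooth_near_id 0) (agree_refl 0 F') FG.
have sFGF : smooth_near 0 ((F \o G) \o F') by apply: smooth_near_comp; rewrite ?F'0.
have := agree_add sFGF sF' (smooth_near_cst (c (xi 0)) 0) (smooth_near_cst _ 0)
  A (agree_refl 0 _).
apply: agree_near2; near=> t; first by rewrite /= /F subrK.
by rewrite /F' /= xe subrK.
Unshelve. all: by end_near. Qed.

(** Freeness: the reading of [xi] in a chart is cancelled on the left by its inverse up to order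
    [r]. *)
Lemma jet_free r xi (f g : 'rV[R]_n -> 'rV[R]_n) :
  regular (X := M) xi -> local_iso f -> local_iso g ->
  same_jet (X := M) r (xi \o f) (xi \o g) -> agree_to_order r 0 f g.
Proof.
move=> rxi [sf f0 _] [sg g0 _] [_ H]; have [c Mc cx] := mcover (xi 0).
have cx' : cdom c ((xi \o f) 0) by rewrite /= f0.
have {}H := H c Mc cx'.
have iF := local_iso_chart rxi Mc cx; set F := (fun t => _) in iF.
have [sF F0 _] := iF.
have [_ sF'] := (smooth0P _).1 rxi.1 c Mc cx.
have [G [[sG G0 _] _ GF]] := local_iso_inverse r iF.
have sxf : smooth_near 0 ((c \o xi) \o f) by apply: smooth_near_comp; rewrite ?f0.
have sxg : smooth_near 0 ((c \o xi) \o g) by apply: smooth_near_comp; rewrite ?g0.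
have sFf : smooth_near 0 (F \o f) by apply: smooth_near_comp; rewrite ?f0.
have sFg : smooth_near 0 (F \o g) by apply: smooth_near_comp; rewrite ?g0.
have FfFg : agree_to_order r 0 (F \o f) (F \o g).
  exact: (agree_add sxf sxg (smooth_near_cst _ 0) (smooth_near_cst _ 0) H
    (agree_refl 0 _)).
have Ff0 : (F \o f) 0 = 0 by rewrite /= f0.
have sGF : smooth_near 0 (G \o F) by apply: smooth_near_comp; rewrite ?F0.
have E (h : 'rV[R]_n -> 'rV[R]_n) : smooth_near 0 h -> h 0 = 0 ->
    agree_to_order r 0 ((G \o F) \o h) h.
  move=> sh h0.
  exact: (agree_comp0 sh sh h0 sGF (smooth_near_id 0) (agree_refl 0 h) GF).
apply: agree_trans (agree_sym (E f sf f0)) _.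
apply: agree_trans _ (E g sg g0).
exact: (agree_comp0 sFf sFg Ff0 sG sG FfFg (agree_refl 0 G)).
Qed.

End Manifold.

(** * The associated bundle *)

Section Representation.
Context {R : realType} (n r m : nat).
Variable lam : set ('rV[R]_n -> 'rV[R]_n) -> 'M[R]_m.
Hypothesis hlam : linear_representation r lam.
Implicit Types f g : 'rV[R]_n -> 'rV[R]_n.

Lemma lam_unit f : local_iso f -> lam (ejet r f) \in unitmx.
Proof. by move=> lf; have [H _ _] := hlam; apply: H; apply/jet_groupP; exists f. Qed.

Lemma lam_comp f g : local_iso f -> local_iso g ->
  lam (ejet r (f \o g)) = lam (ejet r f) *m lam (ejet r g).
Proof.
move=> lf lg; have [_ H _] := hlam; rewrite -H; last 2 first.
- by apply/jet_groupP; exists f.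
- by apply/jet_groupP; exists g.
by rewrite ejet_compE//; case: lf.
Qed.

(** An invertible idempotent matrix is the identity. *)
Lemma lam_id : lam (ejet r id) = 1%:M.
Proof.
have lid := lam_unit (local_iso_id n).
have H : lam (ejet r id) = lam (ejet r id) *m lam (ejet r id).
  exact: (lam_comp (local_iso_id n) (local_iso_id n)).
by rewrite -[LHS](mulKmx lid) -H mulVmx.
Qed.

Lemma lam_agree f g : local_iso f -> local_iso g -> agree_to_order r 0 f g ->
  lam (ejet r f) = lam (ejet r g).
Proof.
by move=> [sf _ _] [sg _ _] fg; congr lam; apply/ejet_eqP.
Qed.

End Representation.

Section Bundle.
Context {R : realType} (n : nat) (M : manifold R n) (r m : nat).
Variable lam : set ('rV[R]_n -> 'rV[R]_n) -> 'M[R]_m.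
Hypothesis hlam : linear_representation r lam.
Implicit Types (f g : 'rV[R]_n -> 'rV[R]_n) (xi eta : 'rV[R]_n -> M).
Implicit Types (v w : 'cV[R]_m) (z : assoc M r lam).

(** For regular germs, this says that the pairs of the jet of [xi] with [v] and of the jet of [eta]
    with [w] lie in one orbit. The action on vectors is written with [lam] on the other side, which
    avoids inverse matrices. *)
Definition same_vector xi v eta w : Prop :=
  exists2 f, local_iso f &
    same_jet (X := M) r eta (xi \o f) /\ lam (ejet r f) *m w = v.

Lemma regular_smooth0 xi : regular (X := M) xi -> smooth0 (X := M) xi.
Proof. by case. Qed.

Lemma regular_comp_smooth0 xi f : regular (X := M) xi -> local_iso f ->
  smooth0 (X := M) (xi \o f).
Proof. by move=> rxi lf; apply: regular_smooth0; exact: regular_comp. Qed.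

Lemma same_vector_refl xi v : same_vector xi v xi v.
Proof.
exists id; first exact: local_iso_id.
by rewrite (lam_id hlam) mul1mx; split => //; exact: same_jet_refl.
Qed.

Lemma same_vector_jet xi v eta : same_jet (X := M) r eta xi ->
  same_vector xi v eta v.
Proof.
exists id; first exact: local_iso_id.
by rewrite (lam_id hlam) mul1mx; split.
Qed.

Lemma same_vector_trans xi v eta w zeta u :
  regular (X := M) xi -> regular (X := M) eta ->
  same_vector xi v eta w -> same_vector eta w zeta u -> same_vector xi v zeta u.
Proof.
move=> rxi reta [f lf [ef fw]] [g lg [zg gu]].
exists (f \o g); first exact: local_iso_comp.
split; last by rewrite (lam_comp hlam)// -mulmxA gu.
have [[sg g0 _] sxf] := (lg, regular_comp_smooth0 rxi lf).
apply: same_jet_trans zg _.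
exact: (same_jet_comp (regular_smooth0 reta) sxf sg sg g0 ef (agree_refl 0 g)).
Qed.

Lemma same_vector_sym xi v eta w :
  regular (X := M) xi -> regular (X := M) eta ->
  same_vector xi v eta w -> same_vector eta w xi v.
Proof.
move=> rxi reta [f lf [ef fw]].
have [g [lg fg gf]] := local_iso_inverse r lf.
have [[sf f0 _] [sg g0 _]] := (lf, lg).
have [sfg _ _] := local_iso_comp lf lg; have sxf := regular_comp_smooth0 rxi lf.
exists g => //; split.
  apply: same_jet_sym.
  have E1 := same_jet_comp (regular_smooth0 reta) sxf sg sg g0 ef (agree_refl 0 g).
  have fg0 : (f \o g) 0 = 0 by rewrite /= g0.
  apply: same_jet_trans E1 _.
  exact: (same_jet_comp (regular_smooth0 rxi) (regular_smooth0 rxi) sfg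
    (smooth_near_id 0) fg0 (same_jet_refl r xi) fg).
rewrite -fw mulmxA -(lam_comp hlam)//.
rewrite (lam_agree lam (local_iso_comp lg lf) (local_iso_id n) gf).
by rewrite (lam_id hlam) mul1mx.
Qed.

Lemma same_vector_base xi v eta w : same_vector xi v eta w -> eta 0 = xi 0.
Proof. by move=> [f [_ f0 _] [[-> _] _]]; rewrite /= f0. Qed.

Lemma same_vector_ex xi v eta : regular (X := M) xi -> regular (X := M) eta ->
  xi 0 = eta 0 -> exists w, same_vector xi v eta w.
Proof.
move=> rxi reta xe; have [f lf ef] := regular_same_base r rxi reta xe.
exists (invmx (lam (ejet r f)) *m v), f => //; split => //.
by rewrite mulKVmx//; exact: (lam_unit hlam).
Qed.

Lemma same_vector_uniq_jet xi f g : regular (X := M) xi -> local_iso f ->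
  local_iso g -> same_jet (X := M) r (xi \o f) (xi \o g) ->
  lam (ejet r f) = lam (ejet r g).
Proof. by move=> rxi lf lg /(jet_free rxi lf lg); exact: lam_agree. Qed.

Lemma same_vector_inj xi v w : regular (X := M) xi -> same_vector xi v xi w ->
  v = w.
Proof.
move=> rxi [f lf [xf <-]].
rewrite (same_vector_uniq_jet rxi lf (local_iso_id n)).
  by rewrite (lam_id hlam) mul1mx.
exact: same_jet_sym.
Qed.

(** The two changes of frame have the same jet by freeness, so one matrix acts on both summands. *)
Lemma same_vector_add xi v1 v2 eta w1 w2 : regular (X := M) xi ->
  same_vector xi v1 eta w1 -> same_vector xi v2 eta w2 ->
  same_vector xi (v1 + v2) eta (w1 + w2).
Proof.
move=> rxi [f lf [ef <-]] [g lg [eg <-]]; exists f => //; split => //.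
rewrite mulmxDr; congr (_ + _ *m _); apply: same_vector_uniq_jet rxi lf lg _.
exact: same_jet_trans (same_jet_sym ef) eg.
Qed.

Lemma same_vector_scale xi k v eta w :
  same_vector xi v eta w -> same_vector xi (k *: v) eta (k *: w).
Proof.
by move=> [f lf [ef <-]]; exists f => //; split => //; rewrite scalemxAr.
Qed.

Lemma orbit_ofP xi v q : regular (X := M) xi ->
  orbit_of r lam (jet (X := M) r xi, v) q <->
  exists eta w, [/\ regular (X := M) eta, q = (jet (X := M) r eta, w) &
    same_vector xi v eta w].
Proof.
move=> rxi; split.
  move=> [G /jet_groupP[f lf ->] ->] /=; have [sf f0 _] := lf.
  exists (xi \o f), (invmx (lam (ejet r f)) *m v).
  rewrite (jet_compE r (regular_smooth0 rxi) sf f0); split=> //.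
    exact: regular_comp.
  exists f => //; split; first exact: same_jet_refl.
  by rewrite mulKVmx//; exact: (lam_unit hlam).
move=> [eta [w [reta -> [f lf [ef fw]]]]]; have [sf f0 _] := lf.
exists (ejet r f); first by apply/jet_groupP; exists f.
rewrite /= (jet_compE r (regular_smooth0 rxi) sf f0) -fw mulKmx; last first.
  exact: (lam_unit hlam).
congr pair.
exact: (jet_eqP r (regular_smooth0 reta) (regular_comp_smooth0 rxi lf)).2.
Qed.

Lemma orbit_eq xi v eta w : regular (X := M) xi -> regular (X := M) eta ->
  same_vector xi v eta w ->
  orbit_of r lam (jet (X := M) r xi, v) = orbit_of r lam (jet (X := M) r eta, w).
Proof.
move=> rxi reta xe; have ex := same_vector_sym rxi reta xe.
apply/seteqP; split=> q.
  move=> /(orbit_ofP _ _ rxi)[zeta [u [rz -> H]]]; apply/(orbit_ofP _ _ reta).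
  by exists zeta, u; split=> //; exact: same_vector_trans ex H.
move=> /(orbit_ofP _ _ reta)[zeta [u [rz -> H]]]; apply/(orbit_ofP _ _ rxi).
by exists zeta, u; split=> //; exact: same_vector_trans xe H.
Qed.

(** Reads [z = [j^r_0 xi, v]]: the vector [v] is the coordinate of [z] in the frame of [xi]. *)
Definition rep z xi v : Prop :=
  regular (X := M) xi /\ aorbit z = orbit_of r lam (jet (X := M) r xi, v).

Lemma rep_ex z : exists xi v, rep z xi v.
Proof.
have [[u v] [[xi rxi /= <-] zE]] := aorbitP z.
by exists xi, v.
Qed.

Lemma ex_rep xi v : regular (X := M) xi -> exists z, rep z xi v.
Proof.
move=> rxi.
have H : exists q, frame_bundle r (X := M) q.1 /\
   orbit_of r lam (jet (X := M) r xi, v) = orbit_of r lam q.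
  by exists (jet (X := M) r xi, v); split => //; exists xi.
by exists (Assoc H).
Qed.

Lemma rep_same z xi v eta w : rep z xi v -> rep z eta w -> same_vector xi v eta w.
Proof.
move=> [rxi zx] [reta ze].
have : aorbit z (jet (X := M) r eta, w).
  rewrite ze; apply/(orbit_ofP _ _ reta); exists eta, w.
  by split => //; exact: same_vector_refl.
rewrite zx => /(orbit_ofP _ _ rxi)[zeta [u [rz [je <-] H]]].
apply: (same_vector_trans rxi rz H); apply: same_vector_jet.
exact: (jet_eqP r (regular_smooth0 reta) (regular_smooth0 rz)).1.
Qed.

Lemma same_rep z xi v eta w : rep z xi v -> regular (X := M) eta ->
  same_vector xi v eta w -> rep z eta w.
Proof. by move=> [rxi zx] reta xe; split=> //; rewrite zx; exact: orbit_eq. Qed.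

Lemma rep_mem z xi v : rep z xi v -> aorbit z (jet (X := M) r xi, v).
Proof.
move=> [rxi ->]; apply/(orbit_ofP _ _ rxi).
by exists xi, v; split => //; exact: same_vector_refl.
Qed.

Lemma mem_rep z u v : aorbit z (u, v) ->
  exists2 xi, u = jet (X := M) r xi & rep z xi v.
Proof.
have [eta [w zE]] := rep_ex z; have [reta ze] := zE.
rewrite ze => /(orbit_ofP _ _ reta)[xi [v' [rxi [-> ->] H]]].
by exists xi => //; exact: same_rep H.
Qed.

Lemma mem_rep_jet z xi v : regular (X := M) xi ->
  aorbit z (jet (X := M) r xi, v) -> rep z xi v.
Proof.
move=> rxi /mem_rep[eta je ze]; apply: (same_rep ze rxi).
have [reta _] := ze; apply: same_vector_jet.
exact: (jet_eqP r (regular_smooth0 rxi) (regular_smooth0 reta)).1.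
Qed.

Lemma assoc_inj z z' : aorbit z = aorbit z' -> z = z'.
Proof.
case: z z' => [A PA] [B PB] /= AB; move: PA; rewrite AB => PA.
by congr Assoc; exact: Prop_irrelevance.
Qed.

Lemma rep_eq z z' xi v : rep z xi v -> rep z' xi v -> z = z'.
Proof. by move=> [_ zx] [_ zx']; apply: assoc_inj; rewrite zx zx'. Qed.

Lemma rep_inj z xi v w : rep z xi v -> rep z xi w -> v = w.
Proof.
move=> zv zw; have [rxi _] := zv; exact: same_vector_inj rxi (rep_same zv zw).
Qed.

(** The point chosen in [assoc_proj] does not depend on the choice, as the base point is constant
    along an orbit. *)
Lemma rep_proj z xi v : rep z xi v -> assoc_proj z = xi 0.
Proof.
move=> zx; rewrite /assoc_proj; case: cid => x [[u w] [[eta [reta /= ue e0]] ze]] /=.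
have H : rep z eta w by split => //; rewrite ze ue.
by rewrite -e0 (same_vector_base (rep_same zx H)).
Qed.

Lemma rep_at z eta : regular (X := M) eta -> assoc_proj z = eta 0 ->
  exists w, rep z eta w.
Proof.
move=> reta; have [xi [v zx]] := rep_ex z; rewrite (rep_proj zx) => xe.
have [rxi _] := zx.
by have [w H] := same_vector_ex v rxi reta xe; exists w; exact: same_rep H.
Qed.

(** Any value that [xget] may choose is represented by a sum in some common frame, and carrying it
    to [xi] is additive; the default is excluded because such a value exists. *)
Lemma rep_add z z' xi v w : rep z xi v -> rep z' xi w ->
  rep (assoc_add z z') xi (v + w).
Proof.
move=> zv zw; have [rxi _] := zv; rewrite /assoc_add.
case: xgetP => [y _ [u [a [b [/mem_rep[eta -> za] zb yab]]]]|H].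
  have [reta _] := za.
  apply: (same_rep (mem_rep_jet reta yab) rxi).
  apply: same_vector_add => //; first exact: rep_same za zv.
  exact: (rep_same (mem_rep_jet reta zb) zw).
have [y yE] := ex_rep (v + w) rxi.
case: (H y); exists (jet (X := M) r xi), v, w.
by split; exact: rep_mem.
Qed.

Lemma rep_scale k z xi v : rep z xi v -> rep (assoc_scale k z) xi (k *: v).
Proof.
move=> zv; have [rxi _] := zv; rewrite /assoc_scale.
case: xgetP => [y _ [u [a [/mem_rep[eta -> za] yab]]]|H].
  have [reta _] := za.
  apply: (same_rep (mem_rep_jet reta yab) rxi).
  by apply: same_vector_scale; exact: rep_same za zv.
have [y yE] := ex_rep (k *: v) rxi.
case: (H y); exists (jet (X := M) r xi), v.
by split; exact: rep_mem.
Qed.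

Definition push (phi : M -> M) z : assoc M r lam :=
  xget z [set y | exists xi v, rep z xi v /\ rep y (phi \o xi) v].

Section Push.
Variables phi psi : M -> M.
Hypotheses (sphi : smooth_map (X := M) (Y := M) phi)
  (spsi : smooth_map (X := M) (Y := M) psi) (phiK : cancel phi psi).

Lemma rep_push z xi v : rep z xi v -> rep (push phi z) (phi \o xi) v.
Proof.
move=> zx; have [rxi _] := zx; have rphi := diffeo_regular sphi spsi phiK.
rewrite /push; case: xgetP => [y _ [eta [w [ze ye]]]|H].
  have [reta _] := ze.
  (* The change of frame [f] acts on the right and [phi] on the left, so the same [f] relates the
     transported frames. *)
  have [f lf [ef fw]] := rep_same ze zx.
  apply: (same_rep ye (rphi _ rxi)); exists f => //; split => //.
  have [c Mc cx] := mcover (xi 0).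
  have [_ /(_ c Mc cx) H] := ef.
  apply: (same_jet_push sphi (regular_smooth0 rxi) (regular_comp_smooth0 reta lf)
    Mc cx _ H).
  by case: ef.
have [y yE] := ex_rep v (rphi _ rxi).
by case: (H y); exists xi, v.
Qed.

Lemma proj_push z : assoc_proj (push phi z) = phi (assoc_proj z).
Proof.
by have [xi [v zx]] := rep_ex z; rewrite (rep_proj zx) (rep_proj (rep_push zx)).
Qed.

End Push.

Lemma push_can phi psi : smooth_map (X := M) (Y := M) phi ->
  smooth_map (X := M) (Y := M) psi -> cancel phi psi -> cancel psi phi ->
  cancel (push phi) (push psi).
Proof.
move=> sphi spsi phiK psiK z; have [xi [v zx]] := rep_ex z.
apply: (rep_eq _ zx).
have := rep_push spsi sphi psiK (rep_push sphi spsi phiK zx).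
by have -> : psi \o (phi \o xi) = xi by apply/funext => t; rewrite /= phiK.
Qed.

End Bundle.

(** * Smoothness of the lift *)

Lemma local_iso_near (R : realType) n (f g : 'rV[R]_n -> 'rV[R]_n) :
  (\forall t \near (0 : 'rV[R]_n), f t = g t) -> local_iso f -> local_iso g.
Proof.
move=> fg [sf f0 bf]; have sg := smooth_near_ext fg sf.
have g0 : g 0 = 0 by rewrite -(nbhs_singleton fg).
have E : 'd f 0 = 'd g 0 :> (_ -> _).
  apply/funext => v.
  apply: etrans (esym (deriveE v (smooth_near_differentiable sf))) _.
  apply: etrans _ (deriveE v (smooth_near_differentiable sg)).
  exact: near_eq_derive.
by split; [exact: sg|exact: g0|rewrite -E; exact: bf].
Qed.

Section Charts.
Context {R : realType} (n : nat) (M : manifold R n).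
Implicit Types (c d : chart M 'rV[R]_n) (x : M) (xi eta : 'rV[R]_n -> M).

Definition frame_at c x xi : Prop :=
  \forall t \near (0 : 'rV[R]_n), cdom c (xi t) /\ c (xi t) = c x + t.

Lemma frame_at0 c x xi : matlas M c -> cdom c x -> frame_at c x xi -> xi 0 = x.
Proof.
move=> Mc cx /nbhs_singleton[cxi]; rewrite addr0 => cE.
by apply: (minj Mc) => //; rewrite inE.
Qed.

Lemma frame_at_ex c x : matlas M c -> cdom c x -> exists xi, frame_at c x xi.
Proof.
move=> Mc cx.
(* The germ of [c^-1 (c x + t)], with [x] as value where this is undefined; openness of the image of
   [c] keeps that away from [t = 0]. *)
exists (fun t => xget x [set x' | cdom c x' /\ c x' = c x + t]).
have oc : open (c @` cdom c).
  by apply: (mopen_map Mc) => //; exact: mopen.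
have xc : \forall y \near c x, (c @` cdom c) y.
  by apply: open_nbhs_nbhs; split=> //; exists x.
have : \forall t \near (0 : 'rV[R]_n), (c @` cdom c) (t + c x).
  by move: xc; rewrite (near_shift 0) subr0.
apply: filterS => t [x' cx' xE].
by apply: (@xgetPex _ x [set x' | cdom c x' /\ c x' = c x + t]); exists x'; rewrite addrC.
Qed.

Lemma smooth_near_addr (x y : 'rV[R]_n) : smooth_near y (fun t => x + t).
Proof. exact: (smooth_near_add (smooth_near_cst x y) (smooth_near_id y)). Qed.

Lemma frame_at_regular c x xi : matlas M c -> cdom c x -> frame_at c x xi ->
  regular (X := M) xi.
Proof.
move=> Mc cx fx; have xi0 := frame_at0 Mc cx fx.
have sxi : smooth0 (X := M) xi.
  apply/smooth0P => d Md; rewrite xi0 => dx.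
  have [h [sh hE]] := smooth_map_id (M := M) Mc Md cx dx.
  have hE' : \forall t \near (0 : 'rV[R]_n), forall x', cdom c x' ->
      c x' = t + c x -> cdom d x' /\ d x' = h (t + c x).
    by move: hE; rewrite (near_shift 0) subr0.
  have H : \forall t \near (0 : 'rV[R]_n), cdom d (xi t) /\ d (xi t) = h (c x + t).
    apply: filterS2 fx hE' => t [cxt cE] /(_ (xi t) cxt).
    by rewrite [t + c x]addrC; exact.
  split; first by apply: filterS H => t [].
  have sh' : smooth_near (c x + 0) h by rewrite addr0.
  apply: (smooth_near_ext _ (smooth_near_comp (smooth_near_addr (c x) 0) sh')).
  by apply: filterS H => t [_ dE]; exact: esym dE.
have cxi : cdom c (xi 0) by rewrite xi0.
have [_ sc] := (smooth0P _).1 sxi c Mc cxi.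
apply: (regular_chart sxi Mc cxi).
have E : 'd (c \o xi) 0 = id :> (_ -> _).
  apply/funext => v.
  apply: etrans (esym (deriveE v (smooth_near_differentiable sc))) _.
  apply: etrans (_ : _ = 'D_v (fun t => (fun=> c x : 'rV[R]_n) t + t) 0) _.
    by apply: near_eq_derive; apply: filterS fx => t [].
  rewrite deriveD; [|exact: derivable_cst|exact: derivable_id].
  by rewrite derive_id derive_cst add0r.
by rewrite E; exists id.
Qed.

Lemma frame_fieldE r c x xi : matlas M c -> cdom c x -> frame_at c x xi ->
  frame_field r c x = jet (X := M) r xi.
Proof.
move=> Mc cx fx; apply/seteqP; split=> eta; last by move=> H; exists xi.
move=> [xi' [fx' H]]; suff <- : jet (X := M) r xi' = jet (X := M) r xi by [].
have [s' _] := frame_at_regular Mc cx fx'; have [s _] := frame_at_regular Mc cx fx.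
have [xi0 xi0'] := (frame_at0 Mc cx fx, frame_at0 Mc cx fx').
apply: (jet_eqP r s' s).2; apply: (same_jet_chart s' s Mc).
- by rewrite xi0'.
- by rewrite xi0 xi0'.
by apply: agree_near; apply: filterS2 fx fx' => t [_ /= ->] [_ ->].
Qed.

End Charts.

Section BundleCharts.
Context {R : realType} (n : nat) (M : manifold R n) (r m : nat).
Variable lam : set ('rV[R]_n -> 'rV[R]_n) -> 'M[R]_m.
Hypothesis hlam : linear_representation r lam.
Implicit Types (c d : chart M 'rV[R]_n) (z : assoc M r lam).

Lemma assoc_chartE c z xi v : matlas M c -> cdom c (assoc_proj z) ->
  frame_at c (assoc_proj z) xi -> rep z xi v ->
  assoc_chart r lam c z = (c (assoc_proj z), v).
Proof.
move=> Mc cz fz zx; rewrite /assoc_chart /=; congr pair.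
rewrite (frame_fieldE r Mc cz fz).
have rxi := frame_at_regular Mc cz fz.
case: xgetP => [w _ zw|H].
  exact: (rep_inj hlam (mem_rep_jet hlam rxi zw) zx).
by case: (H v); exact: rep_mem.
Qed.

Lemma smooth_on_pair (V A B : normedModType R) (U : set V) (f : V -> A) (g : V -> B) :
  open U -> smooth_on U f -> smooth_on U g -> smooth_on U (fun x => (f x, g x)).
Proof.
move=> oU sf sg k.
have l1 : linear (fun a : A => (a, 0 : B)).
  by move=> c a b; congr pair; rewrite /= scaler0 addr0.
have l2 : linear (fun b : B => (0 : A, b)).
  by move=> c a b; congr pair; rewrite /= scaler0 addr0.
have c1 : continuous (fun a : A => (a, 0 : B)).
  by move=> a; apply: cvg_pair; [exact: cvg_id|exact: cvg_cst].
have c2 : continuous (fun b : B => (0 : A, b)).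
  by move=> a; apply: cvg_pair; [exact: cvg_cst|exact: cvg_id].
have := Ck_add oU (Ck_linear oU l1 c1 (sf k)) (Ck_linear oU l2 c2 (sg k)).
apply: Ck_ext => // x _; congr pair; rewrite /= ?addr0 ?add0r //.
Qed.

Lemma smooth_on_mulmx (V : normedModType R) (U : set V) (L : V -> 'M[R]_m)
    (v : V -> 'cV[R]_m) :
  open U -> smooth_on U L -> smooth_on U v -> smooth_on U (fun x => L x *m v x).
Proof.
move=> oU sL sv k; apply: Ck_mx => // i j.
apply: (@Ck_ext _ _ _ _ _ (fun x => \sum_l L x i l *: v x l j)) => //.
  by move=> x _; rewrite mxE.
by apply: Ck_sum => // l _; apply: Ck_scale => //; apply: Ck_coord.
Qed.

Section PushSmooth.
Variables phi psi : M -> M.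
Hypotheses (sphi : smooth_map (X := M) (Y := M) phi)
  (spsi : smooth_map (X := M) (Y := M) psi) (phiK : cancel phi psi).

(* [f] is the representative of the element of the jet group by which the chart
   frame at [phi x] differs from the image of the chart frame at [x]. *)
Lemma push_frame c d h x xi eta : matlas M c -> matlas M d -> cdom c x ->
  cdom d (phi x) -> frame_at c x xi -> frame_at d (phi x) eta ->
  smooth_near (c x) h ->
  (\forall y \near c x, forall x', cdom c x' -> c x' = y ->
     cdom d (phi x') /\ d (phi x') = h y) ->
  let f := fun t => h (c x + t) - h (c x) in
  local_iso f /\ same_jet (X := M) r (phi \o xi) (eta \o f).
Proof.
move=> Mc Md cx dx fx fe sh hE f.
have rxi := frame_at_regular Mc cx fx; have reta := frame_at_regular Md dx fe.
have [xi0 eta0] := (frame_at0 Mc cx fx, frame_at0 Md dx fe).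
have rphi : regular (X := M) (phi \o xi) := diffeo_regular sphi spsi phiK rxi.
have dx' : cdom d ((phi \o xi) 0) by rewrite /= xi0.
have hx : d (phi x) = h (c x) := (nbhs_singleton hE x cx erefl).2.
have hE' : \forall t \near (0 : 'rV[R]_n), forall x', cdom c x' ->
    c x' = t + c x -> cdom d (phi x') /\ d (phi x') = h (t + c x).
  by move: hE; rewrite (near_shift 0) subr0.
(* Both germs to be compared read [d (phi x) + f t] in the chart [d], so they agree near [0] and not
   merely to order [r]. *)
have dphi : \forall t \near (0 : 'rV[R]_n), d (phi (xi t)) = d (phi x) + f t.
  apply: filterS2 fx hE' => t [ct cE] /(_ (xi t) ct).
  rewrite [t + c x]addrC => /(_ cE)[_ ->].
  by rewrite hx /f [RHS]addrC subrK.
have lf : local_iso f.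
  apply: local_iso_near (local_iso_chart rphi Md dx').
  by apply: filterS dphi => t /= ->; rewrite xi0 addrC addKr.
split=> //; have [sf f0 _] := lf.
apply: (same_jet_chart (regular_smooth0 rphi) (regular_comp_smooth0 reta lf) Md dx').
  by rewrite /= f0 eta0 xi0.
have etaf : \forall t \near (0 : 'rV[R]_n), d (eta (f t)) = d (phi x) + f t.
  have cf := smooth_near_continuous sf.
  have : \forall t \near (0 : 'rV[R]_n), cdom d (eta (f t)) /\
      d (eta (f t)) = d (phi x) + f t.
    apply: (cf (fun y => cdom d (eta y) /\ d (eta y) = d (phi x) + y)).
    by rewrite f0.
  by apply: filterS => t [].
by apply: agree_near; apply: filterS2 dphi etaf => t /= -> ->.
Qed.

Lemma smooth_push :
  smooth_map (X := assoc_bundle M r lam) (Y := assoc_bundle M r lam)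
    (push (r := r) (lam := lam) phi).
Proof.
move=> z0 _ _ [c Mc <-] [d Md <-] /= cz0; rewrite (proj_push hlam sphi spsi phiK) => dz0.
have [h [[U0 [oU0 U0z] sh] hE]] := sphi Mc Md cz0 dz0.
set Q : set 'rV[R]_n := fun y => forall x', _ in hE.
have oc : open (c @` cdom c) by apply: (mopen_map Mc) => //; exact: mopen.
(* The interior of [Q] is taken because at each [y] of [U] the expression [h] must be valid on a
   whole neighbourhood, as its derivatives at [y] enter. *)
pose U := (U0 `&` (c @` cdom c)) `&` Q°.
have oU : open U by do 2?apply: openI => //; exact: open_interior.
have Uz : U (c (assoc_proj z0)).
  by split; [split => //; exists (assoc_proj z0)|exact: hE].
have {}sh : smooth_on U h by move=> k; apply: Ck_sub (sh k) => y [[]].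
pose T := taylor_coeffs r h.
pose Lam y := lam (ejet r (poly_map (T y))).
have key y : U y -> exists2 x, cdom c x & [/\ c x = y, cdom d (phi x),
    d (phi x) = h y, jet_group r (ejet r (poly_map (T y))) &
    forall z v, assoc_proj z = x -> assoc_chart r lam c z = (y, v) ->
      assoc_chart r lam d (push phi z) = (h y, Lam y *m v)].
  move=> Uy; have [[U0y [x cx xy]] Qy] := Uy.
  have hEy : \forall y' \near c x, forall x', cdom c x' -> c x' = y' ->
     cdom d (phi x') /\ d (phi x') = h y' by rewrite xy; exact: Qy.
  have [dx hx] := nbhs_singleton hEy x cx erefl.
  have shy : smooth_near (c x) h by rewrite xy; exists U => //; split.
  have [xi fx] := frame_at_ex Mc cx; have [eta fe] := frame_at_ex Md dx.
  have [] := push_frame Mc Md cx dx fx fe shy hEy.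
  set f := (fun t => _) => lf jf.
  (* Replacing [f] by its Taylor polynomial puts the jet in the global chart of the jet group, where
     [lam] is assumed smooth. *)
  have fT : ejet r f = ejet r (poly_map (T y)).
    have [sf _ _] := lf; apply: (ejet_eqP r sf (smooth_near_poly_map _ 0)).2.
    by rewrite /T -xy; exact: taylor.
  exists x => //; split=> //; first by rewrite hx xy.
    by rewrite -fT; apply/jet_groupP; exists f.
  move=> z v zx zv.
  have rxi := frame_at_regular Mc cx fx; have reta := frame_at_regular Md dx fe.
  have rphi := diffeo_regular sphi spsi phiK rxi.
  have z0x : assoc_proj z = xi 0 by rewrite zx (frame_at0 Mc cx fx).
  have [v' zv'] := rep_at hlam rxi z0x.
  have zc : cdom c (assoc_proj z) by rewrite zx.
  have fz : frame_at c (assoc_proj z) xi by rewrite zx.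
  have vE : v' = v by have := assoc_chartE Mc zc fz zv'; rewrite zv => -[].
  have zp := rep_push hlam sphi spsi phiK zv'.
  (* The frame [phi \o xi] is [eta \o f], so passing from it to the chart frame [eta] multiplies the
     coordinate by the matrix of [f]. *)
  have zeta : rep (push phi z) eta (Lam y *m v).
    apply: (same_rep hlam zp reta); apply: (same_vector_sym hlam reta rphi).
    by exists f => //; split; [exact: jf|rewrite fT vE].
  have pz : assoc_proj (push (r := r) (lam := lam) phi z) = phi x.
    by rewrite (proj_push hlam sphi spsi phiK) zx.
  have zd : cdom d (assoc_proj (push (r := r) (lam := lam) phi z)) by rewrite pz.
  have fd : frame_at d (assoc_proj (push (r := r) (lam := lam) phi z)) eta by rewrite pz.
  by rewrite (assoc_chartE Md zd fd zeta) pz hx xy.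
exists (fun p => (h p.1, Lam p.1 *m p.2)); split.
  (* The local expression is linear in the vector, so it is smooth on the whole cylinder over
     [U]. *)
  pose V : set ('rV[R]_n * 'cV[R]_m) := fst @^-1` U.
  have oV : open V by apply: open_comp => // p _; exact: cvg_fst.
  have l1 : linear (fst : 'rV[R]_n * 'cV[R]_m -> _) by [].
  have l2 : linear (snd : 'rV[R]_n * 'cV[R]_m -> _) by [].
  have c1 : continuous (fst : 'rV[R]_n * 'cV[R]_m -> _) by move=> p; exact: cvg_fst.
  have c2 : continuous (snd : 'rV[R]_n * 'cV[R]_m -> _) by move=> p; exact: cvg_snd.
  have s1 : smooth_on V fst := fun k => Ck_linear oV l1 c1 (Ck_id k V).
  have s2 : smooth_on V snd := fun k => Ck_linear oV l2 c2 (Ck_id k V).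
  exists V; first by split.
  apply: smooth_on_pair => //.
    by move=> k; apply: (@Ck_comp _ _ _ _ _ _ V U fst h).
  apply: smooth_on_mulmx => // k.
  apply: (@Ck_comp _ _ _ _ _ _ V U fst Lam) => //.
  have [_ _ slam] := hlam.
  apply: (@Ck_comp _ _ _ _ _ _ U _ T _ oU _ _ (slam k)).
    by move=> y /key[x _ []].
  exact: smooth_on_taylor_coeffs.
have oV : open ((fst : 'rV[R]_n * 'cV[R]_m -> _) @^-1` U).
  by apply: open_comp => // p _; exact: cvg_fst.
apply: (open_near oV) => // p Up z' cz' zp.
have [x cx [cxE dx dxE _ zE]] := key _ Up.
have xz : assoc_proj z' = x.
  apply: (minj Mc); rewrite ?inE //.
  by rewrite cxE -zp.
have zv : assoc_chart r lam c z' = (p.1, p.2) by rewrite -surjective_pairing.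
split; last exact: (zE z' p.2 xz zv).
by rewrite (proj_push hlam sphi spsi phiK) xz.
Qed.

End PushSmooth.
End BundleCharts.

(** * The lift as a bundle automorphism over the given diffeomorphism *)

Section Automorphism.
Context {R : realType} (n : nat) (M : manifold R n) (r m : nat).
Variable lam : set ('rV[R]_n -> 'rV[R]_n) -> 'M[R]_m.
Hypothesis hlam : linear_representation r lam.
Variables phi psi : M -> M.
Hypotheses (sphi : smooth_map (X := M) (Y := M) phi)
  (spsi : smooth_map (X := M) (Y := M) psi)
  (phiK : cancel phi psi) (psiK : cancel psi phi).

Lemma push_fibre x : fibre_iso (V := assoc_bundle M r lam) x (phi x)
  (push (r := r) (lam := lam) phi).
Proof.
have pP := proj_push hlam sphi spsi phiK.
have K := push_can hlam sphi spsi phiK psiK.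
have K' := push_can hlam spsi sphi psiK phiK.
(* Two vectors of one fibre are written in a common frame, where the lift leaves coordinates
   unchanged; linearity follows. *)
have frame (z w : assoc M r lam) : assoc_proj z = assoc_proj w ->
    exists xi v1 v2, rep (r := r) (lam := lam) z xi v1 /\ rep w xi v2.
  have [xi [v1 zx]] := rep_ex z => zw.
  have [rxi _] := zx; rewrite (rep_proj hlam zx) in zw.
  by have [v2 wx] := rep_at hlam rxi (esym zw); exists xi, v1, v2.
split.
- split.
  + by move=> z zx; exact: etrans (pP z) (congr1 phi zx).
  + by move=> z w _ _ /(can_inj K).
  + move=> w wx; exists (push psi w); last exact: K'.
    exact: etrans (proj_push hlam spsi sphi psiK w)
      (etrans (congr1 psi wx) (phiK x)).
- move=> z w /= zx wx.
  have [xi [v1 [v2 [z1 w2]]]] := frame z w (etrans zx (esym wx)).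
  have pz := rep_push hlam sphi spsi phiK z1.
  have pw := rep_push hlam sphi spsi phiK w2.
  exact: (rep_eq (rep_push hlam sphi spsi phiK (rep_add hlam z1 w2))
    (rep_add hlam pz pw)).
- move=> k z /= zx; have [xi [v z1]] := rep_ex z.
  have pz := rep_push hlam sphi spsi phiK z1.
  exact: (rep_eq (rep_push hlam sphi spsi phiK (rep_scale hlam k z1))
    (rep_scale hlam k pz)).
Qed.

Lemma push_AUT : AUT (V := assoc_bundle M r lam) (push (r := r) (lam := lam) phi).
Proof.
split; last by move=> x; exists (phi x); exact: push_fibre.
split; first exact: (smooth_push hlam sphi spsi phiK).
exists (push (r := r) (lam := lam) psi); first exact: (smooth_push hlam spsi sphi psiK).
split; first exact: (push_can hlam sphi spsi phiK psiK).
exact: (push_can hlam spsi sphi psiK phiK).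
Qed.

Lemma h_V_push : h_V (V := assoc_bundle M r lam) (push (r := r) (lam := lam) phi) = phi.
Proof.
have pP := proj_push hlam sphi spsi phiK.
apply/funext => x; rewrite /h_V; case: xgetP => [y _ H|H].
  (* The zero vector in a chart frame shows that the fibre over [x] is nonempty, which forces the
     chosen value to be [phi x]. *)
  have [c Mc cx] := mcover x; have [xi fx] := frame_at_ex Mc cx.
  have [z zx] := ex_rep r lam 0 (frame_at_regular Mc cx fx).
  have zE : assoc_proj z = x by rewrite (rep_proj hlam zx) (frame_at0 Mc cx fx).
  by rewrite -(H z zE) /= pP zE.
by case: (H (phi x)) => z /= zx; rewrite pP zx.
Qed.

End Automorphism.

Theorem proposition5 (R : realType) (n : nat) (M : manifold R n) (r m : nat)
    (hr : (1 <= r)%N) (lam : set ('rV[R]_n -> 'rV[R]_n) -> 'M[R]_m)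
    (hlam : linear_representation r lam) :
  set_surj (AUT (V := assoc_bundle M r lam)) (Diff (X := M))
    (h_V (V := assoc_bundle M r lam)).
Proof.
move=> phi [sphi [psi spsi [phiK psiK]]].
exists (push (r := r) (lam := lam) phi); first exact: (push_AUT hlam sphi spsi phiK psiK).
exact: (h_V_push hlam sphi spsi phiK).
Qed.
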